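(* Let $\mathfrak{g}$ be a symmetrizable Kac--Moody algebra over $\mathbb{C}$ with Cartan subalgebra $\mathfrak{h}$, root system $\Phi$ and set of simple roots $\Pi$. Let $\mathfrak{s}\subseteq\mathfrak{g}$ be a regular subalgebra (a Lie subalgebra normalized by $\mathfrak{h}$) such that $\mathfrak{h}\subseteq\mathfrak{s}$, and let $$T=\{\alpha\in\Phi \mid \mathfrak{s}\cap\mathfrak{g}_\alpha\neq\{0\}\}$$ be its associated closed subset of $\Phi$. If $$\Pi\subseteq \operatorname{cl}_{\mathrm{re}}(T\cup(-T)),$$ then $\mathfrak{s}$ is wide, that is, every irreducible integrable highest weight $\mathfrak{g}$-module is indecomposable as an $\mathfrak{s}$-module upon restriction.
   Context: **Kac--Moody algebra.** Let $A=(a_{ij})$ be an $\ell\times\ell$ generalized Cartan matrix ($a_{ii}=2$; $a_{ij}\in\mathbb{Z}_{\le 0}$ for $i\ne j$; $a_{ij}=0\Rightarrow a_{ji}=0$) that is symmetrizable: there is a diagonal matrix $D=\mathrm{diag}(d_i)$ with all $d_i>0$ such that $DA$ is symmetric. A realization of $A$ is a triple $(\mathfrak{h},\Pi,\Pi^\vee)$ with $\mathfrak{h}$ a complex vector space of dimension $2\ell-\operatorname{rank}(A)$, and $\Pi=\{\alpha_1,\dots,\alpha_\ell\}\subset\mathfrak{h}^*$, $\Pi^\vee=\{\alpha_1^\vee,\dots,\alpha_\ell^\vee\}\subset\mathfrak{h}$ linearly independent sets with $\alpha_j(\alpha_i^\vee)=a_{ij}$. The associated symmetrizable Kac--Moody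 algebra $\mathfrak{g}=\mathfrak{g}(A)$ is the complex Lie algebra generated by $\mathfrak{h}$ and $e_i,f_i$ ($1\le i\le\ell$) with relations $[h,h']=0$, $[e_i,f_j]=\delta_{ij}\alpha_i^\vee$, $[h,e_i]=\alpha_i(h)e_i$, $[h,f_i]=-\alpha_i(h)f_i$ for $h,h'\in\mathfrak{h}$, and $(\operatorname{ad}e_i)^{1-a_{ij}}e_j=0=(\operatorname{ad}f_i)^{1-a_{ij}}f_j$ for $i\neq j$. The elements of $\Pi$ are the simple roots. **Roots.** $\mathfrak{g}=\mathfrak{h}\oplus\bigoplus_{\alpha\in\Phi}\mathfrak{g}_\alpha$, where $\mathfrak{g}_\alpha=\{x\in\mathfrak{g}\mid [h,x]=\alpha(h)x\ \forall h\in\mathfrak{h}\}$ and $\Phi\subset\mathfrak{h}^*\setminus\{0\}$ is the root system. Let $(\cdot\mid\cdot)$ be the bilinear form on $\mathfrak{h}^*$ induced by a standard invariant symmetric bilinear form on $\mathfrak{g}$ (nondegenerate on $\mathfrak{h}$, with $(\alpha_i\mid\alpha_i)>0$ and $a_{ij}=2(\alpha_i\mid\alpha_j)/(\alpha_i\mid\alpha_i)$). The set of real roots is $\Phi_{\mathrm{re}}=\{\alpha\in\Phi\mid(\alpha\mid\alpha)>0\}$. **Closedness.** A subset $S\subseteq\Phi$ is closed if $\alpha,\beta\in S$ and $\alpha+\beta\in\Phi$ imply $\alpha+\beta\in S$. A subset $S\subseteq\Phi_{\mathrm{re}}$ is real closed if $\alpha,\beta\in S$ and $\alpha+\beta\in\Phi_{\mathrm{re}}$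 imply $\alpha+\beta\in S$. For $S\subseteq\Phi$, the real closure $\operatorname{cl}_{\mathrm{re}}(S)$ is the smallest real closed subset of $\Phi_{\mathrm{re}}$ containing $S\cap\Phi_{\mathrm{re}}$. **Regular subalgebras.** A Lie subalgebra $\mathfrak{s}\subseteq\mathfrak{g}$ is regular if $[\mathfrak{h},\mathfrak{s}]\subseteq\mathfrak{s}$; then $\mathfrak{s}=(\mathfrak{s}\cap\mathfrak{h})\oplus\bigoplus_{\alpha\in\Phi}(\mathfrak{s}\cap\mathfrak{g}_\alpha)$. **Modules.** A weight module is a $\mathfrak{g}$-module $V=\bigoplus_{\mu\in\mathfrak{h}^*}V_\mu$ with $V_\mu=\{v\mid hv=\mu(h)v\ \forall h\in\mathfrak{h}\}$. It is a highest weight module of highest weight $\lambda$ if there is a nonzero $v_\lambda\in V$ with $e_iv_\lambda=0$ for all $i$, $hv_\lambda=\lambda(h)v_\lambda$ for all $h\in\mathfrak{h}$, and $V=U(\mathfrak{g})v_\lambda$. It is integrable if all $e_i$ and $f_i$ act locally nilpotently on $V$. A module is indecomposable if it is not a direct sum of two nonzero submodules. *)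

(* Defs.v *)
From HB Require Import structures.
From mathcomp Require Import all_boot all_order all_algebra sesquilinear.
From mathcomp Require Import boolp classical_sets reals.
From mathcomp Require Export complex.

Set Implicit Arguments.
Unset Strict Implicit.
Unset Printing Implicit Defensive.

Import Order.TTheory GRing.Theory Num.Theory.
Local Open Scope ring_scope.
Local Open Scope classical_set_scope.

HB.mixin Record Lmodule_isLieAlgebra (K : fieldType) L of GRing.Lmodule K L := {
  lie : L -> L -> L;
  lie_linearl : forall y, linear (lie^~ y);
  lie_linearr : forall x, linear (lie x);
  lie_alt : forall x, lie x x = 0;
  lie_jacobi : forall x y z,
    lie x (lie y z) + lie y (lie z x) + lie z (lie x y) = 0
}.

#[short(type="lieAlgType")]
HB.structure Definition LieAlgebra (K : fieldType) :=
  {L of GRing.Lmodule K L & Lmodule_isLieAlgebra K L}.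

Notation dual K h := 'Hom(h, (K : fieldType)^o).

Section LinearAlgebra.
Variables (K : fieldType) (V : lmodType K).

Definition is_subspace (W : set V) :=
  W 0 /\ forall (a : K) u v, W u -> W v -> W (a *: u + v).

Definition is_direct_sum (I : eqType) (W : I -> set V) :=
  (forall v, exists (s : seq I) (w : I -> V),
     [/\ uniq s, forall i, W i (w i) & v = \sum_(i <- s) w i]) /\
  (forall (s : seq I) (w : I -> V), uniq s -> (forall i, W i (w i)) ->
     \sum_(i <- s) w i = 0 -> forall i, i \in s -> w i = 0).

End LinearAlgebra.

Section CartanMatrix.
Variables (l : nat) (A : 'M[int]_l).

Definition is_GCM :=
  [/\ forall i, A i i = 2,
      forall i j, i != j -> A i j <= 0
    & forall i j, A i j = 0 -> A j i = 0].

Definition mxC (C : numClosedFieldType) : 'M[C]_l := map_mx intr A.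

(* In a numClosedFieldType, [0 < z] says that z is real and positive. *)
Definition symmetrizable (C : numClosedFieldType) :=
  exists d : 'rV[C]_l, (forall i, 0 < d 0 i) /\
    (diag_mx d *m mxC C)^T = diag_mx d *m mxC C.

Definition is_realization (C : numClosedFieldType) (h : vectType C)
    (alpha : 'I_l -> dual C h) (alphav : 'I_l -> h) :=
  [/\ \dim {:h} = (2 * l - \rank (mxC C))%N,
      free (codom alpha),
      free (codom alphav)
    & forall i j, alpha j (alphav i) = (A i j)%:~R].

End CartanMatrix.

Section Presentation.
Variables (C : numClosedFieldType) (l : nat) (A : 'M[int]_l).
Variables (h : vectType C) (alpha : 'I_l -> dual C h) (alphav : 'I_l -> h).

Definition KM_relations (L : lieAlgType C) (iota : h -> L) (e f : 'I_l -> L) :=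
  [/\ forall t t', lie (iota t) (iota t') = 0,
      forall i j, lie (e i) (f j) = if i == j then iota (alphav i) else 0,
      forall t i, lie (iota t) (e i) = alpha i t *: e i,
      forall t i, lie (iota t) (f i) = - alpha i t *: f i
    & forall i j, i != j ->
        iter `|1 - A i j|%N (lie (e i)) (e j) = 0 /\
        iter `|1 - A i j|%N (lie (f i)) (f j) = 0].

Definition is_subalgebra (L : lieAlgType C) (s : set L) :=
  is_subspace s /\ forall x y, s x -> s y -> s (lie x y).

(* g is the Lie algebra presented by the generators h, e_i, f_i (the vector
   space structure of h being kept: iota is linear) and the relations above. *)
Definition is_KacMoody (g : lieAlgType C) (iota : {linear h -> g})
    (e f : 'I_l -> g) :=
  [/\ KM_relations iota e f,
      forall s : set g, is_subalgebra s -> (forall t, s (iota t)) ->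
        (forall i, s (e i)) -> (forall i, s (f i)) -> s = setT
    & forall (L : lieAlgType C) (iota' : {linear h -> L}) (e' f' : 'I_l -> L),
        KM_relations iota' e' f' ->
        exists phi : {linear g -> L},
          [/\ forall x y, phi (lie x y) = lie (phi x) (phi y),
              forall t, phi (iota t) = iota' t,
              forall i, phi (e i) = e' i
            & forall i, phi (f i) = f' i]].

End Presentation.

Section Roots.
Variables (C : numClosedFieldType) (h : vectType C) (g : lieAlgType C).
Variable iota : {linear h -> g}.

Definition root_space (a : dual C h) : set g :=
  [set x | forall t, lie (iota t) x = a t *: x].

Definition roots : set (dual C h) :=
  [set a | a <> 0 /\ exists2 x, root_space a x & x <> 0].

Variable B : {biscalar g}.

(* nu is the map h -> h^*, t |-> (t | .); when B is nondegenerate on h it is an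
   isomorphism, and the form on h^* is transported along it. *)
Definition nu : 'Hom(h, dual C h) :=
  linfun (fun t : h =>
    linfun (fun t' : h => B (iota t) (iota t') : C^o) : dual C h).

Definition dual_form (a b : dual C h) : C :=
  B (iota ((nu^-1)%VF a)) (iota ((nu^-1)%VF b)).

Definition is_standard_form (l : nat) (A : 'M[int]_l)
    (alpha : 'I_l -> dual C h) :=
  [/\ forall x y, B x y = B y x,
      forall x y z, B (lie x y) z = B x (lie y z),
      forall t, (forall t', B (iota t) (iota t') = 0) -> t = 0,
      forall i, 0 < dual_form (alpha i) (alpha i)
    & forall i j, (A i j)%:~R =
        2 * dual_form (alpha i) (alpha j) / dual_form (alpha i) (alpha i)].

Definition real_roots : set (dual C h) :=
  [set a | roots a /\ 0 < dual_form a a].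

Definition real_closed (S : set (dual C h)) :=
  S `<=` real_roots /\
  forall a b, S a -> S b -> real_roots (a + b) -> S (a + b).

Definition real_closure (S : set (dual C h)) : set (dual C h) :=
  smallest real_closed (S `&` real_roots).

Definition is_regular (s : set g) :=
  is_subalgebra s /\ forall t x, s x -> s (lie (iota t) x).

Definition root_set (s : set g) : set (dual C h) :=
  [set a | roots a /\ exists2 x, (s `&` root_space a) x & x <> 0].

End Roots.

Section Modules.
Variables (C : numClosedFieldType) (g : lieAlgType C).
Variables (V : lmodType C) (rho : g -> V -> V).

Definition is_module :=
  [/\ forall v, linear (rho^~ v),
      forall x, linear (rho x)
    & forall x y v, rho (lie x y) v = rho x (rho y v) - rho y (rho x v)].

Definition is_submodule (s : set g) (W : set V) :=
  is_subspace W /\ forall x v, s x -> W v -> W (rho x v).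

Definition irreducible_module :=
  (exists v : V, v <> 0) /\
  forall W, is_submodule setT W -> W = [set 0] \/ W = setT.

Definition indecomposable_over (s : set g) :=
  ~ exists W1 W2 : set V,
      [/\ is_submodule s W1, is_submodule s W2,
          W1 <> [set 0] /\ W2 <> [set 0],
          W1 `&` W2 = [set 0]
        & forall v, exists v1 v2, [/\ W1 v1, W2 v2 & v = v1 + v2]].

(* U(g)v: linear combinations of the vectors x_1 (x_2 ( ... (x_k v))). *)
Definition Ug_span (v : V) : set V :=
  [set w | exists s : seq (C * seq g),
     w = \sum_(p <- s) p.1 *: foldr rho v p.2].

Variables (h : vectType C) (iota : {linear h -> g}) (l : nat).
Variables (e f : 'I_l -> g).

Definition weight_space (mu : dual C h) : set V :=
  [set v | forall t, rho (iota t) v = mu t *: v].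

Definition is_weight_module := is_direct_sum weight_space.

Definition is_highest_weight (lambda : dual C h) :=
  is_weight_module /\
  exists v : V,
    [/\ v <> 0, forall i, rho (e i) v = 0, weight_space lambda v
      & Ug_span v = setT].

Definition is_integrable :=
  forall i v, (exists n, iter n (rho (e i)) v = 0) /\
              (exists n, iter n (rho (f i)) v = 0).

End Modules.

Definition wide (C : numClosedFieldType) (h : vectType C) (g : lieAlgType C)
    (iota : {linear h -> g}) (l : nat) (e f : 'I_l -> g) (s : set g) :=
  forall (V : lmodType C) (rho : g -> V -> V) (lambda : dual C h),
    is_module rho -> irreducible_module rho -> is_integrable rho e f ->
    is_highest_weight rho iota e lambda ->
    indecomposable_over rho s.

(* Main.v *)
Require Import Defs.
From HB Require Import structures.
From mathcomp Require Import all_boot all_order all_algebra sesquilinear.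
From mathcomp Require Import boolp classical_sets reals.
From mathcomp Require Import ring zify.

(* Suppose V = W1 + W2 is a decomposition over s, and let p be the projection
   onto W1 along W2; p commutes with s, in particular with h. If a is a real
   root, V is an integrable module over the sl2 spanned by g_a, g_(-a) and
   their bracket, so an operator of weight 0 commuting with g_a also commutes
   with g_(-a). Since [g_a, g_b] = g_(a + b) when a, b and a + b are real, the
   real roots a such that p commutes with g_a form a real closed set, which
   contains the real roots of T and -T, hence the simple roots. So p commutes
   with all e_i, then with all f_i, hence with g, and W1 is a g-submodule of the
   irreducible module V.

   The facts needed about a real root a (root spaces of a and -a are lines,
   paired nontrivially by the invariant form, with vectors acting locally
   nilpotently) are transported from the simple roots along simple reflections
   without integrating sl2 to a group: when a(alpha_i^vee) = -n <= 0, the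
   operators e_i^n and f_i^n are injective on the weight spaces involved, and
   local nilpotency follows from a bound on a-strings of weights, which is
   invariant under reflections. *)

Import Order.TTheory GRing.Theory Num.Theory.
Local Open Scope ring_scope.
Local Open Scope classical_set_scope.

Set Implicit Arguments.
Unset Strict Implicit.

(** * Linear maps given as plain functions *)

Section LinearPredicate.
Variables (K : fieldType) (U V : lmodType K) (F : U -> V).
Hypothesis linF : linear F.

Lemma lin0 : F 0 = 0.
Proof. by rewrite -{1}(addNr 0) -scaleN1r linF scaleN1r addNr. Qed.

Lemma linZ a u : F (a *: u) = a *: F u.
Proof. by rewrite -[a *: u]addr0 linF lin0 addr0. Qed.

Lemma linD u v : F (u + v) = F u + F v.
Proof. by rewrite -[u in u + v]scale1r linF scale1r. Qed.

Lemma linN u : F (- u) = - F u.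
Proof. by rewrite -scaleN1r linZ scaleN1r. Qed.

Lemma linB u v : F (u - v) = F u - F v.
Proof. by rewrite linD linN. Qed.

End LinearPredicate.

Lemma iter_linear (K : fieldType) (V : lmodType K) (F : V -> V) n :
  linear F -> linear (iter n F).
Proof. by move=> lF; elim: n => [|n IHn] a u v //=; rewrite IHn lF. Qed.

Lemma iter_zero_le (K : fieldType) (V : lmodType K) (F : V -> V) m n v :
  linear F -> (m <= n)%N -> iter m F v = 0 -> iter n F v = 0.
Proof.
move=> lF mn Fv; rewrite -(subnK mn) iterD Fv.
exact: lin0 (iter_linear _ lF).
Qed.

(** * Locally nilpotent sl2-triples *)

Section SL2.
Variables (C : numFieldType) (V : lmodType C).
Implicit Types (E F H : V -> V) (v : V).

(** The relations $[H,E]=2E$ and $[H,F]=-2F$ are asked only on eigenvectors of [H], where they are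
    used; linearity of [H] follows from $H=EF-FE$. *)
Definition sl2_triple E F H :=
  [/\ linear E, linear F, (forall v, E (F v) = F (E v) + H v),
      forall c v, H v = c *: v -> H (E v) = (c + 2) *: E v
    & forall c v, H v = c *: v -> H (F v) = (c - 2) *: F v].

Definition locally_nilpotent F := forall v, exists n, iter n F v = 0.

(** Exchanges raising and lowering, so that each result about [F] also yields its mirror image about
    [E]. *)
Lemma sl2_swap E F H : sl2_triple E F H -> sl2_triple F E (\- H).
Proof.
case=> lE lF EF HE HF; split=> //= [v|c v|c v].
- by rewrite EF addrK.
- by move/eqP; rewrite eqr_oppLR -scaleNr => /eqP/HF ->;
  rewrite -scaleNr opprB addrC opprK.
- by move/eqP; rewrite eqr_oppLR -scaleNr => /eqP/HE ->;
  rewrite -scaleNr opprD opprK.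
Qed.

Lemma wtN H c v : H v = c *: v -> (\- H) v = (- c) *: v.
Proof. by move=> /= ->; rewrite scaleNr. Qed.

Section Triple.
Variables E F H : V -> V.
Hypothesis t : sl2_triple E F H.

Let lE : linear E. Proof. by case: t. Qed.
Let lF : linear F. Proof. by case: t. Qed.
Let lFn n : linear (iter n F). Proof. exact: iter_linear. Qed.

Lemma sl2_linearH : linear H.
Proof.
case: t => _ _ EF _ _ a u v.
have EF' w : H w = E (F w) - F (E w) by rewrite EF addrC addKr.
by rewrite !EF' !lF !lE lF scalerBr opprD addrACA.
Qed.

Lemma weight_iterF c v n : H v = c *: v ->
  H (iter n F v) = (c - 2 * n%:R) *: iter n F v.
Proof.
move=> Hv; elim: n => [|n IHn] /=; first by rewrite mulr0 subr0.
by case: t => _ _ _ _ /(_ _ _ IHn) ->; congr (_ *: _); rewrite -natr1; ring.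
Qed.

Lemma sl2_comm c v k : H v = c *: v ->
  E (iter k.+1 F v) = iter k.+1 F (E v) + (k.+1%:R * (c - k%:R)) *: iter k F v.
Proof.
move=> Hv; case: (t) => _ _ EF _ _.
elim: k => [|k IHk]; first by rewrite /= EF Hv subr0 mul1r.
rewrite iterS EF IHk (weight_iterF k.+1 Hv) (linD lF) (linZ lF).
rewrite -addrA -scalerDl -!iterS; congr (_ + _ *: _).
by rewrite -!natr1; ring.
Qed.

(** By [sl2_comm], $E F^{k+1}v=(k+1)(n-k)F^kv$, and the coefficient is nonzero as long as $k<n$. *)
Lemma iterF_highest_inj n v k : E v = 0 -> H v = n%:R *: v -> (k <= n)%N ->
  iter k F v = 0 -> v = 0.
Proof.
move=> Ev Hv; elim: k => [//|k IHk] kn Fv.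
apply: IHk (ltnW kn) _; have := sl2_comm k Hv.
rewrite Fv (lin0 lE) Ev (lin0 (lFn _)) add0r => /esym/eqP.
rewrite scaler_eq0 mulf_eq0 pnatr_eq0 /= subr_eq0 eqr_nat => /orP[|/eqP //].
by rewrite gtn_eqF.
Qed.

(** For the least $n$ with $F^{n+1}v=0$, [sl2_comm] gives $(n+1)(c-n)F^nv=0$, which forces $c=n$. *)
Lemma highest_weight_nat c v : v <> 0 -> E v = 0 -> H v = c *: v ->
  (exists n, iter n F v = 0) -> exists n : nat, c = n%:R /\ iter n.+1 F v = 0.
Proof.
move=> v0 Ev Hv exN.
have /ex_minnP[[|n] /eqP Fn min_n] : exists n, iter n F v == 0.
- by case: exN => n /eqP; exists n.
- by case: v0.
exists n; split=> //; have := sl2_comm n Hv.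
rewrite Fn (lin0 lE) Ev (lin0 (lFn _)) add0r => /esym/eqP.
rewrite scaler_eq0 mulf_eq0 pnatr_eq0 /= subr_eq0 => /orP[/eqP //|/min_n].
by rewrite ltnn.
Qed.

Lemma iterE_iterF_highest n v k : E v = 0 -> H v = n%:R *: v -> (k <= n)%N ->
  exists2 d, d != 0 & iter k E (iter k F v) = d *: v.
Proof.
move=> Ev Hv; elim: k => [|k IHk] kn; first by exists 1;
  rewrite ?oner_neq0 ?scale1r.
have [d d0 EFv] := IHk (ltnW kn).
exists (k.+1%:R * (n%:R - k%:R) * d).
  by rewrite !mulf_neq0 ?pnatr_eq0 // subr_eq0 eqr_nat gtn_eqF.
rewrite iterSr (sl2_comm k Hv) Ev (lin0 (lFn _)) add0r.
by rewrite (linZ (iter_linear _ lE)) EFv scalerA.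
Qed.

(** Induction on the order of nilpotency of [E] at [v]: the vector [E v] has weight $n+2$ and is
    killed by $F^{j+1}$, hence vanishes, and the highest weight case applies. *)
Lemma iterF_inj n v j : H v = n%:R *: v -> (exists N, iter N E v = 0) ->
  (j <= n)%N -> iter j F v = 0 -> v = 0.
Proof.
move=> Hv [N]; elim: N n v j Hv => [//|N IHN] n v j Hv EN jn Fj.
suff Ev : E v = 0 by apply: iterF_highest_inj Ev Hv jn Fj.
have HE : H (E v) = n.+2%:R *: E v.
  by case: t => _ _ _ /(_ _ _ Hv) -> _; rewrite -natrD addn2.
apply: (IHN n.+2 _ j.+1 HE); rewrite -?iterSr ?(ltnW jn) //;
  first exact: leq_trans jn _.
have /eqP := sl2_comm j Hv; rewrite [iter j.+1 F v]iterS Fj (lin0 lF) (lin0 lE).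
by rewrite scaler0 addr0 => /eqP.
Qed.

(** If [F v] is nonzero, it is a highest weight vector of weight $m$, so $F^{m+2}v=0$; but $F^{m+2}$
    is injective on weight $m+2$. *)
Lemma EF_positive_inj m v : H v = (m + 2)%:R *: v -> locally_nilpotent E ->
  locally_nilpotent F -> E (F v) = 0 -> v = 0.
Proof.
move=> Hv nE nF EFv.
have HFv : H (F v) = m%:R *: F v.
  by case: t => _ _ _ _ /(_ _ _ Hv) ->; rewrite natrD addrK.
apply: (iterF_inj Hv (nE v) (leqnn _)); rewrite addn2 iterSr.
have [->|/eqP Fv0] := eqVneq (F v) 0; first exact: lin0.
have [k [/eqP + Fk]] := highest_weight_nat Fv0 EFv HFv (nF _).
by rewrite eqr_nat => /eqP ->.
Qed.

(** Powers of [E] raise the weight by steps of 2 up to a highest weight vector, whose weight is a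
    natural number. *)
Lemma weight_int c v : v <> 0 -> H v = c *: v ->
  locally_nilpotent E -> locally_nilpotent F -> exists z : int, c = z%:~R.
Proof.
move=> + + nE nF; have [N EN] := nE v.
elim: N c v EN => [//|N IHN] c v; rewrite iterSr => EN v0 Hv.
have [Ev|/eqP Ev] := eqVneq (E v) 0.
  by have [n [-> _]] := highest_weight_nat v0 Ev Hv (nF v); exists n.
have HE : H (E v) = (c + 2) *: E v by case: t => _ _ _ /(_ _ _ Hv).
have [z /eqP] := IHN _ _ EN Ev HE; rewrite -subr_eq0 => /eqP cz.
by exists (z - 2); rewrite rmorphB -[c]subr0 -cz /=; ring.
Qed.

End Triple.

Lemma iterE_inj E F H n v j : sl2_triple E F H ->
  H v = - n%:R *: v -> (exists N, iter N F v = 0) ->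
  (j <= n)%N -> iter j E v = 0 -> v = 0.
Proof.
move=> /sl2_swap t /wtN; rewrite opprK => Hv exN jn Ej.
exact: (iterF_inj t Hv exN jn Ej).
Qed.

(** The defect $q=pF-Fp$ commutes with [E] and lowers weights by 2. It vanishes on weight vectors by
    induction on the order of nilpotency of [F] at [v]: subtracting a multiple of $E^MF^Mv$, on
    which [q] vanishes, lowers this order. *)
Lemma sl2_commutant E F H (p : V -> V) : sl2_triple E F H ->
  locally_nilpotent E -> locally_nilpotent F -> linear p ->
  (forall v, p (E v) = E (p v)) -> (forall v, p (H v) = H (p v)) ->
  forall c v, H v = c *: v -> p (F v) = F (p v).
Proof.
move=> t nE nF lp pE pH.
have [lE lF EF HE HF] := t; have lH := sl2_linearH t.
pose q v := p (F v) - F (p v).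
suff qE : forall c v, H v = c *: v -> q v = 0.
  by move=> c v Hv; apply: subr0_eq (qE _ _ Hv).
have lq : linear q.
  by move=> a u v; rewrite /q lF !lp lF opprD addrACA scalerBr.
have Eq v : E (q v) = q (E v).
  by rewrite /q (linB lE) -pE !EF (linD lp) pH pE opprD addrACA subrr addr0.
have Eqn n v : iter n E (q v) = q (iter n E v).
  by elim: n => [//|n IHn] /=; rewrite IHn Eq.
have Hq d v : H v = d *: v -> H (q v) = (d - 2) *: q v.
  move=> Hv; have Hpv : H (p v) = d *: p v by rewrite -pH Hv (linZ lp).
  have := HF _ _ Hpv; have := congr1 p (HF _ _ Hv).
  rewrite pH (linZ lp) /q => e1 e2.
  by rewrite (linB lH) e1 e2 scalerBr.
move=> c v; have [N] := nF v; elim: N v c => [v c /= -> _|M IHM v c FM Hv].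
  exact: lin0 lq.
set w := iter M F v.
have Fw : F w = 0 by [].
have [w0|/eqP w0] := eqVneq w 0; first by apply: IHM Hv.
have Hw : H w = (c - 2 * M%:R) *: w by exact: (weight_iterF t M Hv).
have [m [cm Em]] : exists m : nat, - (c - 2 * M%:R) = m%:R /\ iter m.+1 E w = 0.
  exact: (highest_weight_nat (sl2_swap t) w0 Fw (wtN Hw) (nE w)).
have {cm}cm : c = 2 * M%:R - m%:R by rewrite -cm; ring.
(* If $m<M$, the weight $c=2M-m$ of [v] is at least $M+1$, so $F^{M+1}v=0$ already forces $v=0$. *)
have [Mm|mM] := leqP M m; last first.
  suff v0 : v = 0 by rewrite v0 (lin0 lq).
  have cn : c = (2 * M - m)%:R by rewrite cm natrB ?natrM //; lia.
  by rewrite cn in Hv; apply: (iterF_inj t (j := M.+1) Hv (nE v)) => //; lia.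
have Hw' : H w = - m%:R *: w by rewrite Hw cm; congr (_ *: _); ring.
(* The vector [q w] has weight $-(m+2)$, on which $E^{m+1}$ is injective, while
   $E^{m+1}qw=qE^{m+1}w=0$. *)
have qw : q w = 0.
  apply: (iterE_inj (n := m.+2) (j := m.+1) t _ (nF _)) => //; last first.
    by rewrite Eqn Em (lin0 lq).
  by rewrite (Hq _ _ Hw'); congr (_ *: _); rewrite -addn2 natrD; ring.
have [d d0 FEw] : exists2 d, d != 0 & iter M F (iter M E w) = d *: w.
  apply: (iterE_iterF_highest (sl2_swap t) Fw) Mm.
  by rewrite (wtN Hw') opprK.
pose u := iter M E w.
have Eqk k : q (iter k E w) = 0 by rewrite -Eqn qw (lin0 (iter_linear _ lE)).
have Hu : H u = c *: u.
  have /= := weight_iterF (sl2_swap t) M (wtN Hw') => /eqP.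
  rewrite eqr_oppLR -scaleNr => /eqP ->; congr (_ *: _).
  by rewrite cm; ring.
have : q (v - d^-1 *: u) = 0.
  apply: (IHM _ c).
    rewrite (linB (iter_linear _ lF)) (linZ (iter_linear _ lF)) FEw scalerA.
    by rewrite mulVf // scale1r subrr.
  by rewrite (linB lH) (linZ lH) Hu Hv scalerBr !scalerA mulrC.
by rewrite (linB lq) (linZ lq) Eqk scaler0 subr0.
Qed.

End SL2.

(** * Weight vectors *)

Inductive lin_span (K : fieldType) (V : lmodType K) (G : set V) : V -> Prop :=
| lin_span0 : lin_span G 0
| lin_spanS a x y : G x -> lin_span G y -> lin_span G (a *: x + y).

Section Span.
Variables (K : fieldType) (V : lmodType K) (G : set V).

Lemma lin_span_subspace : is_subspace (lin_span G).
Proof.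
split=> [|a u v]; first exact: lin_span0.
move=> Gu Gv; elim: Gu => [|b x y Gx _ IHy]; first by rewrite scaler0 add0r.
by rewrite scalerDr -addrA scalerA; exact: lin_spanS.
Qed.

Lemma lin_span_sub x : G x -> lin_span G x.
Proof. by move=> Gx; rewrite -[x]addr0 -[x]scale1r;
  apply/lin_spanS/lin_span0. Qed.

Lemma lin_span_min (W : set V) x : is_subspace W -> G `<=` W -> lin_span G x ->
  W x.
Proof. by case=> W0 WD GW; elim=> [//|a y z /GW Wy _ Wz]; exact: WD. Qed.

Lemma lin_span_nonzero x : lin_span G x -> x <> 0 -> exists2 y, G y & y <> 0.
Proof.
elim=> [//|a y z Gy _ IHz nz].
have [y0|/eqP y0] := eqVneq y 0; last by exists y.
by apply: IHz => z0; apply: nz; rewrite y0 z0 scaler0 addr0.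
Qed.

End Span.

Lemma lin_span_image (K : fieldType) (U V : lmodType K) (F : U -> V)
    (G : set U) (G' : set V) x :
  linear F -> (forall y, G y -> lin_span G' (F y)) -> lin_span G x ->
  lin_span G' (F x).
Proof.
move=> lF GF; elim=> [|a y z Gy _ IHz]; first by rewrite (lin0 lF);
  exact: lin_span0.
by rewrite lF; apply: (lin_span_subspace G').2 => //; exact: GF.
Qed.

Lemma subspaceZ (K : fieldType) (V : lmodType K) (W : set V) a u :
  is_subspace W -> W u -> W (a *: u).
Proof. by case=> W0 WD Wu; rewrite -[_ *: _]addr0; exact: WD. Qed.

Lemma subspaceD (K : fieldType) (V : lmodType K) (W : set V) u v :
  is_subspace W -> W u -> W v -> W (u + v).
Proof. by case=> W0 WD Wu Wv; rewrite -[u]scale1r; exact: WD. Qed.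

Lemma subspaceB (K : fieldType) (V : lmodType K) (W : set V) u v :
  is_subspace W -> W u -> W v -> W (u - v).
Proof. by case=> W0 WD Wu Wv; rewrite addrC -scaleN1r; exact: WD. Qed.

Lemma lieC (C : numClosedFieldType) (g : lieAlgType C) (x y : g) : lie x y = - lie y x.
Proof.
have := lie_alt (x + y); rewrite (linD (lie_linearl _)) !(linD (lie_linearr _)).
by rewrite !lie_alt add0r addr0 => /eqP; rewrite addr_eq0 => /eqP.
Qed.

(** Lets every result on modules apply to the adjoint representation, for which [weight_space]
    unfolds to [root_space]. *)
Lemma lie_module (C : numClosedFieldType) (g : lieAlgType C) : is_module (@lie C g).
Proof.
split=> [y|x|x y z]; [exact: lie_linearl|exact: lie_linearr|].
have := lie_jacobi x y z; rewrite [lie z (lie x y)]lieC => /subr0_eq <-.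
by rewrite [lie z x]lieC (linN (lie_linearr _)).
Qed.

Section Stabilizer.
Variables (C : numClosedFieldType) (g : lieAlgType C) (M : lmodType C).
Variable rho : g -> M -> M.
Hypothesis rhoM : is_module rho.

(** With the generation of [g] by [h], the [e i] and the [f i], this reduces stability under [g] to
    stability under generators. *)
Lemma stabilizer_subalgebra (W : set M) : is_subspace W ->
  is_subalgebra [set x | forall v, W v -> W (rho x v)].
Proof.
case: rhoM => ll lr lb Ws; split; first split=> [v _|a x y Wx Wy v Wv] /=.
- by rewrite (lin0 (ll v)); case: Ws.
- by rewrite ll; apply: (proj2 Ws); [exact: (Wx v Wv)|exact: (Wy v Wv)].
- move=> x y Wx Wy v Wv /=; rewrite lb.
  by apply: (subspaceB Ws); [exact: (Wx _ (Wy v Wv))|exact: (Wy _ (Wx v Wv))].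
Qed.

Lemma commutant_subalgebra (p : M -> M) : linear p ->
  is_subalgebra [set x | forall v, p (rho x v) = rho x (p v)].
Proof.
case: rhoM => ll lr lb lp; split; first split=> [v|a x y px py v] /=.
- by rewrite !(lin0 (ll _)) (lin0 lp).
- by rewrite !ll lp px py.
- move=> x y px py v /=. rewrite !lb (linB lp).
  by rewrite (px (rho y v)) (py (rho x v)) (px v) (py v).
Qed.

End Stabilizer.

(** Since [lie x] is a derivation, the Leibniz rule applies. Local nilpotency of [lie x] thus needs
    checking on generators only. *)
Lemma ad_nilpotent_subalgebra (C : numClosedFieldType) (g : lieAlgType C) (x : g) :
  is_subalgebra [set y | exists n, iter n (lie x) y = 0].
Proof.
have lx := lie_linearr x; have lxn n := @iter_linear _ _ _ n lx.
split; first split=> [|a u v [m mu] [n nv]] /=; first by exists 0%N.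
  exists (m + n)%N; rewrite lxn (iter_zero_le lx (leq_addr _ _) mu).
  by rewrite (iter_zero_le lx (leq_addl _ _) nv) scaler0 addr0.
suff leibniz k m n y z : (m + n = k)%N -> iter m (lie x) y = 0 ->
    iter n (lie x) z = 0 -> iter k (lie x) (lie y z) = 0.
  by move=> y z [m my] [n nz]; exists (m + n)%N; exact: leibniz my nz.
elim: k m n y z => [|k IHk] [|m] [|n] y z //= mn.
- by move=> -> _; rewrite (lin0 (lie_linearl _)).
- by move=> -> _; rewrite (lin0 (lie_linearl _)) -iterS (lin0 (lxn _)).
- by move=> _ ->; rewrite (lin0 (lie_linearr _)) -iterS (lin0 (lxn _)).
move=> my nz; rewrite -iterS iterSr.
have -> : lie x (lie y z) = lie (lie x y) z + lie y (lie x z).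
  by have [_ _ ->] := lie_module g; rewrite subrK.
rewrite (linD (lxn _)) (IHk m n.+1) ?add0r ?(IHk m.+1 n) ?addr0 //; try lia;
  by rewrite ?iterSr // -?iterSr.
Qed.

Section Weights.
Variables (C : numClosedFieldType) (h : vectType C) (g : lieAlgType C).
Variables (iota : {linear h -> g}) (M : lmodType C) (rho : g -> M -> M).
Hypothesis rhoM : is_module rho.
Implicit Types (a b mu : dual C h).

Notation wt := (weight_space rho iota).

Lemma weight_subspace mu : is_subspace (wt mu).
Proof.
case: rhoM => _ lr _; split=> [t|a u v uw vw t];
  first by rewrite (lin0 (lr _)) scaler0.
by rewrite lr uw vw scalerDr !scalerA mulrC.
Qed.

Lemma weight_uniq mu nu v : v <> 0 -> wt mu v -> wt nu v -> mu = nu.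
Proof.
move=> /eqP v0 vm vn; apply/lfunP => t; have := vm t; rewrite vn => /eqP.
by rewrite -subr_eq0 -scalerBl scaler_eq0 (negPf v0) orbF subr_eq0 => /eqP.
Qed.

Lemma rho_weight a mu x v : root_space iota a x -> wt mu v ->
  wt (mu + a) (rho x v).
Proof.
case: rhoM => ll lr lb xa vm t; have := lb (iota t) x v.
rewrite xa (linZ (ll v)) vm (linZ (lr x)) => /eqP;
  rewrite eq_sym subr_eq => /eqP ->.
by rewrite -scalerDl add_lfunE addrC.
Qed.

Lemma iter_rho_weight a mu x v n :
  root_space iota a x -> wt mu v -> wt (mu + a *+ n) (iter n (rho x) v).
Proof.
move=> xa vm; elim: n => [|n IHn] /=; first by rewrite mulr0n addr0.
by rewrite mulrSr addrA; exact: rho_weight.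
Qed.

Inductive off_weight b : M -> Prop :=
| off_weight0 : off_weight b 0
| off_weightS mu v w : mu <> b -> wt mu v -> off_weight b w ->
  off_weight b (v + w).

(* A product of operators [rho (iota t) - mu t] kills [v] and acts by a nonzero
   scalar on the weight space of [b]. *)
Lemma off_weight_eq0 b v : wt b v -> off_weight b v -> v = 0.
Proof.
case: rhoM => _ lr _ vb ov.
suff [P [lP Pw [d d0 Pb] Pv]] : exists P : M -> M, [/\ linear P,
    forall mu, exists d, forall w, wt mu w -> P w = d *: w,
    exists2 d, d != 0 & forall w, wt b w -> P w = d *: w & P v = 0].
  by apply/eqP; move/eqP: Pv; rewrite Pb // scaler_eq0 (negPf d0).
elim: ov {vb} => [|mu w z mub wmu _ [P [lP Pw [d d0 Pb] Pz]]].
  exists id; split=> //; first by move=> mu; exists 1 => w; rewrite scale1r.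
  by exists 1; rewrite ?oner_neq0 // => w; rewrite scale1r.
have [t tmu] : exists t, b t != mu t.
  apply: contrapT => nt; apply: mub; apply/lfunP => t; apply/eqP.
  by apply/negP => /negP tn; apply: nt; exists t; rewrite eq_sym.
have act c x nu : wt nu x -> rho (iota t) (c *: x) - mu t *: (c *: x) =
    ((nu t - mu t) * c) *: x.
  by move=> xn; rewrite (linZ (lr _)) xn !scalerA -scalerBl mulrBl mulrC.
exists (fun x => rho (iota t) (P x) - mu t *: P x); split.
- move=> c x y; rewrite lP lr scalerDr !scalerA [mu t * c]mulrC -!scalerA.
  by rewrite scalerBr opprD addrACA.
- move=> nu; have [c Pc] := Pw nu.
  by exists ((nu t - mu t) * c) => x xn; rewrite Pc // (act _ _ nu).
- exists ((b t - mu t) * d); first by rewrite mulf_neq0 // subr_eq0.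
  by move=> x xb; rewrite Pb // (act _ _ b).
- have [c Pc] := Pw mu.
  by rewrite (linD lP) Pz addr0 Pc // (act _ _ mu) // subrr mul0r scale0r.
Qed.

(** Split [v] into a part of weight [b] and a sum of vectors of other weights; the latter is also a
    difference of vectors of weight [b], hence zero. *)
Lemma weight_span (G : set M) b v : (forall x, G x -> exists mu, wt mu x) ->
  lin_span G v -> wt b v -> lin_span (G `&` wt b) v.
Proof.
move=> Gw Gv vb.
have [y [z [Gy oz vE]]] : exists y z,
    [/\ lin_span (G `&` wt b) y, off_weight b z & v = y + z].
  elim: Gv {vb} => [|a x w Gx _ [y [z [Gy oz ->]]]].
    by exists 0, 0; rewrite addr0; split=> //;
      [exact: lin_span0|exact: off_weight0].
  have [xb|xb] := pselect (wt b x).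
    by exists (a *: x + y), z; rewrite addrA; split=> //; exact: lin_spanS.
  have [mu xmu] := Gw x Gx; exists y, (a *: x + z); split=> //;
    last by rewrite addrCA.
  apply: (@off_weightS _ mu) => //; first by move=> mub; apply: xb;
    rewrite -mub.
  exact: subspaceZ (weight_subspace mu) xmu.
suff z0 : z = 0 by rewrite vE z0 addr0.
apply: off_weight_eq0 oz; have -> : z = v - y by rewrite vE addrC addKr.
apply: (subspaceB (weight_subspace b)) => //.
by apply: lin_span_min Gy; [exact: weight_subspace|move=> x []].
Qed.

Lemma weight_span_nonzero (G : set M) b v : (forall x, G x ->
  exists mu, wt mu x) ->
  lin_span G v -> wt b v -> v <> 0 -> exists y, [/\ G y, wt b y & y <> 0].
Proof.
move=> Gw Gv vb v0; have [y [Gy yb] y0] :=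
  lin_span_nonzero (weight_span Gw Gv vb) v0.
by exists y.
Qed.

End Weights.

(** * Triangular decomposition *)

Section Monomials.
Variables (C : numClosedFieldType) (l : nat) (h : vectType C) (g : lieAlgType C).
Variables (alpha : 'I_l -> dual C h) (alphav : 'I_l -> h).
Variables (iota : h -> g) (e f : 'I_l -> g).
Hypothesis ef : forall i j, lie (e i) (f j) = if i == j then iota (alphav i) else 0.
Hypothesis te : forall t i, lie (iota t) (e i) = alpha i t *: e i.

Definition word_weight (s : seq 'I_l) : dual C h := \sum_(i <- s) alpha i.

(** The nested bracket $[e_{j_1},[\dots,[e_{j_k},e_i]]]$. The innermost letter [i] is kept apart so
    that the word [i :: s] is never empty. *)
Definition lie_mon (i : 'I_l) (s : seq 'I_l) : g :=
  foldr (fun j => lie (e j)) (e i) s.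

Definition borel_gen : set g :=
  [set x | (exists t, x = iota t) \/ exists i s, x = lie_mon i s].

Lemma word_weight_cons i s : word_weight (i :: s) = alpha i + word_weight s.
Proof. exact: big_cons. Qed.

Lemma lie_mon_weight t i s :
  lie (iota t) (lie_mon i s) = word_weight (i :: s) t *: lie_mon i s.
Proof.
have [ll lr lb] := lie_module g.
elim: s => [|j s IHs]; first by rewrite /word_weight big_seq1 te.
have /eqP := lb (iota t) (e j) (lie_mon i s).
rewrite te (linZ (ll _)) IHs (linZ (lr _)) eq_sym subr_eq => /eqP /= ->.
by rewrite -scalerDl !word_weight_cons !add_lfunE addrCA.
Qed.

Lemma lie_mon_eq0 i k s : all (pred1 k) (i :: k :: s) -> lie_mon i (k :: s) = 0.
Proof.
have [ll lr lb] := lie_module g.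
move=> /= /and3P[/eqP -> _ ].
elim: s => [|j s IHs] /=; first by rewrite lie_alt.
by case/andP=> /eqP -> /IHs ->; rewrite (lin0 (lr _)).
Qed.

Lemma lie_e_borel j x : borel_gen x -> lin_span borel_gen (lie (e j) x).
Proof.
case=> [[t ->]|[i [s ->]]].
  rewrite lieC te -scaleNr; apply: subspaceZ; first exact: lin_span_subspace.
  by apply: lin_span_sub; right; exists j, [::].
by apply: lin_span_sub; right; exists i, (j :: s).
Qed.

(** In $[f_j,[e_k,x]]=[[f_j,e_k],x]+[e_k,[f_j,x]]$ the first term is a multiple of the weight vector
    $x$, and the second is covered by induction. *)
Lemma lie_f_borel j i s : lin_span borel_gen (lie (f j) (lie_mon i s)).
Proof.
have [ll lr lb] := lie_module g; have sub := lin_span_subspace borel_gen.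
have fe k : lie (f j) (e k) = if k == j then - iota (alphav k) else 0.
  by rewrite lieC ef; case: ifP; rewrite ?oppr0.
elim: s => [|k s IHs] /=.
  rewrite fe; case: ifP => _; last exact: lin_span0.
  by rewrite -scaleN1r; apply: subspaceZ => //; apply: lin_span_sub; left;
    exists (alphav i).
have /eqP := lb (f j) (e k) (lie_mon i s); rewrite eq_sym subr_eq => /eqP ->.
apply: subspaceD => //; last first.
  by apply: lin_span_image IHs; [exact: lr|exact: lie_e_borel].
rewrite fe; case: ifP => _; last by rewrite (lin0 (ll _)); exact: lin_span0.
rewrite (linN (ll _)) lie_mon_weight -scaleNr; apply: subspaceZ => //.
by apply: lin_span_sub; right; exists i, s.
Qed.

Lemma lie_t_borel t x : (forall t t', lie (iota t) (iota t') = 0) ->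
  borel_gen x -> lin_span borel_gen (lie (iota t) x).
Proof.
move=> tt; case=> [[t' ->]|[i [s ->]]]; first by rewrite tt; exact: lin_span0.
rewrite lie_mon_weight; apply: subspaceZ; first exact: lin_span_subspace.
by apply: lin_span_sub; right; exists i, s.
Qed.

End Monomials.

(** Provides linear forms reading off the coefficients of the simple roots; signs and heights of
    roots are compared through them. *)
Lemma free_coordinates (C : fieldType) (W : vectType C) (l : nat) (alpha : 'I_l -> W) :
  free (codom alpha) ->
  exists2 c : 'I_l -> W -> C, (forall i, linear (c i : W -> C^o)) &
    forall i j, c i (alpha j) = (i == j)%:R.
Proof.
move=> fa; pose X := codom_tuple alpha.
exists (fun i w => coord X (enum_rank i) w) => [i a u v|i j];
  first by rewrite linearP.
have -> : alpha j = X`_(enum_rank j).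
  by rewrite /= /X /= codomE (nth_map j) ?nth_enum_rank // -cardE ltn_ord.
by rewrite coord_free // (inj_eq enum_rank_inj) eq_sym.
Qed.

Section RootStructure.
Variables (C : numClosedFieldType) (l : nat) (A : 'M[int]_l).
Variables (h : vectType C) (alpha : 'I_l -> dual C h) (alphav : 'I_l -> h).
Variables (g : lieAlgType C) (iota : {linear h -> g}) (e f : 'I_l -> g).
Hypothesis alpha_free : free (codom alpha).
Hypothesis rels : KM_relations A alpha alphav iota e f.
Hypothesis gen : forall s : set g, is_subalgebra s -> (forall t, s (iota t)) ->
  (forall i, s (e i)) -> (forall i, s (f i)) -> s = setT.
Variable cf : 'I_l -> dual C h -> C.
Hypothesis cf_lin : forall i, linear (cf i : dual C h -> C^o).
Hypothesis cf_alpha : forall i j, cf i (alpha j) = (i == j)%:R.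

Notation ww := (word_weight alpha).
Notation rs := (root_space iota).

Let tt : forall t t', lie (iota t) (iota t') = 0. Proof. by case: rels. Qed.
Let ef : forall i j, lie (e i) (f j) = if i == j then iota (alphav i) else 0.
Proof. by case: rels. Qed.
Let te : forall t i, lie (iota t) (e i) = alpha i t *: e i. Proof.
  by case: rels. Qed.
Let tf : forall t i, lie (iota t) (f i) = - alpha i t *: f i. Proof.
  by case: rels. Qed.

(** The Chevalley involution: [nu], [f], [e] satisfy the relations assumed above for [iota], [e],
    [f], so the results on the positive Borel subalgebra also hold for the negative one. *)
Let nu t := - iota t.
Let fe i j : lie (f i) (e j) = if i == j then nu (alphav i) else 0.
Proof. by rewrite lieC ef eq_sym; case: eqP => [->|]; rewrite ?oppr0. Qed.
Let nuf t i : lie (nu t) (f i) = alpha i t *: f i.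
Proof.
by rewrite /nu (linN (lie_linearl _)) tf scaleNr opprK.
Qed.

Lemma generated_stable (M : lmodType C) (rho : g -> M -> M) (W : set M) :
  is_module rho -> is_subspace W -> (forall t v, W v -> W (rho (iota t) v)) ->
  (forall i v, W v -> W (rho (e i) v)) -> (forall i v, W v ->
    W (rho (f i) v)) ->
  forall x v, W v -> W (rho x v).
Proof.
move=> rhoM Ws Wt We Wf x v Wv.
have : [set: g] x by [].
by rewrite -(gen (stabilizer_subalgebra rhoM Ws) Wt We Wf) => Wx;
  exact: (Wx v Wv).
Qed.

Definition triangular_gen : set g := borel_gen iota e `|` borel_gen nu f.

(** The span is stable under the adjoint action of the generators, hence of [g]; it is then a
    subalgebra, and it contains the generators. *)
Lemma triangular_span x : lin_span triangular_gen x.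
Proof.
have subl y : lin_span (borel_gen iota e) y -> lin_span triangular_gen y.
  by apply: lin_span_min; [exact: lin_span_subspace|move=> z zG;
    apply: lin_span_sub; left].
have subr y : lin_span (borel_gen nu f) y -> lin_span triangular_gen y.
  by apply: lin_span_min; [exact: lin_span_subspace|move=> z zG;
    apply: lin_span_sub; right].
have sub := lin_span_subspace triangular_gen.
have [ll lr lb] := lie_module g.
have st t y : lin_span triangular_gen y ->
  lin_span triangular_gen (lie (iota t) y).
  apply: (lin_span_image (lr _)) => {}y [yG|yG].
    by apply: subl; exact: (lie_t_borel te t tt yG).
  have -> : lie (iota t) y = -1 *: lie (nu t) y.
    by rewrite /nu (linN (ll _)) scaleN1r opprK.
  apply: subspaceZ => //.
  apply: subr; apply: (lie_t_borel nuf) => // {}t t'.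
  by rewrite /nu (linN (ll _)) (linN (lr _)) tt !oppr0.
have se i y : lin_span triangular_gen y ->
  lin_span triangular_gen (lie (e i) y).
  apply: (lin_span_image (lr _)) => {}y [yG|[[t ->]|[j [s ->]]]].
  - by apply: subl; apply: (lie_e_borel te).
  - apply: subl; rewrite /nu (linN (lr _)) -scaleN1r; apply: subspaceZ;
    first exact: lin_span_subspace.
    by apply: (lie_e_borel te); left; exists t.
  - by apply: subr; apply: (lie_f_borel fe nuf).
have sf i y : lin_span triangular_gen y ->
  lin_span triangular_gen (lie (f i) y).
  apply: (lin_span_image (lr _)) => {}y [[[t ->]|[j [s ->]]]|yG].
  - apply: subr; have -> : lie (f i) (iota t) = -1 *: lie (f i) (nu t).
      by rewrite /nu (linN (lr _)) scaleN1r opprK.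
    apply: subspaceZ; first exact: lin_span_subspace.
    by apply: (lie_e_borel nuf); left; exists t.
  - by apply: subl; apply: (lie_f_borel ef te).
  - by apply: subr; apply: (lie_e_borel nuf).
have stab := generated_stable (lie_module g) sub st se sf.
have : is_subalgebra (lin_span triangular_gen) by split=> // y z _; exact: stab.
move/gen => span_all; have : [set: g] x by [].
rewrite -span_all // => [t|i|i].
- by apply: subl; apply: lin_span_sub; left; exists t.
- by apply: subl; apply: lin_span_sub; right; exists i, [::].
- by apply: subr; apply: lin_span_sub; right; exists i, [::].
Qed.

Lemma iota_weight t : rs 0 (iota t).
Proof. by move=> t'; rewrite tt zero_lfunE scale0r. Qed.

Lemma e_weight i : rs (alpha i) (e i).
Proof. by move=> t; rewrite te. Qed.

Lemma f_weight i : rs (- alpha i) (f i).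
Proof. by move=> t; rewrite tf opp_lfunE. Qed.

Lemma cf_word i s : cf i (ww s) = (count_mem i s)%:R.
Proof.
elim: s => [|j s IHs]; first by rewrite /word_weight big_nil (lin0 (cf_lin i)).
by rewrite word_weight_cons (linD (cf_lin i)) cf_alpha IHs /= natrD eq_sym.
Qed.

(* A root multiple of [alpha i] is [alpha i] or [- alpha i]: an iterated bracket
   of two or more copies of [e i] vanishes. *)
Lemma triangular_gen_weight y a : triangular_gen y -> rs a y -> y <> 0 ->
  [\/ a = 0 /\ exists t, y = iota t,
      exists s, [/\ s != [::], a = ww s & forall i, all (pred1 i) s ->
        s = [:: i] /\ y = e i]
    | exists s, [/\ s != [::], a = - ww s & forall i, all (pred1 i) s ->
      s = [:: i] /\ y = f i]].
Proof.
have uniq b z : rs a z -> rs b z -> z <> 0 -> a = b.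
  by move=> za zb z0; apply: (weight_uniq (rho := lie) z0 za zb).
case=> [|] [[t ->]|[i [s ->]]] ya y0.
- by constructor 1; split; [exact: uniq (iota_weight t) y0|exists t].
- constructor 2; exists (i :: s); split=> //.
    by apply: uniq y0 => // t; rewrite (lie_mon_weight te).
  move=> k; case: s ya y0 => [|j s] ya y0 alls.
    by move: alls; rewrite /= andbT => /eqP ->.
  by case: y0; move: alls (alls) => /=; case/and3P => _ /eqP -> _;
    exact: lie_mon_eq0.
- constructor 1; split; last by exists (- t); rewrite linearN.
  apply: uniq y0 => //; rewrite /nu => t'.
  by rewrite (linN (lie_linearr _)) tt oppr0 zero_lfunE scale0r.
- constructor 3; exists (i :: s); split=> //.
    apply: uniq y0 => // t; have := lie_mon_weight nuf t i s.
    by rewrite /nu (linN (lie_linearl _)) opp_lfunE scaleNr => <-;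
      rewrite opprK.
  move=> k; case: s ya y0 => [|j s] ya y0 alls.
    by move: alls; rewrite /= andbT => /eqP ->.
  by case: y0; move: alls (alls) => /=; case/and3P => _ /eqP -> _;
    exact: lie_mon_eq0.
Qed.

End RootStructure.

(** * Integrable modules and strings of weights *)

Section IntegrableModules.
Variables (C : numClosedFieldType) (l : nat) (A : 'M[int]_l).
Variables (h : vectType C) (alpha : 'I_l -> dual C h) (alphav : 'I_l -> h).
Variables (g : lieAlgType C) (iota : {linear h -> g}) (e f : 'I_l -> g).
Hypothesis rels : KM_relations A alpha alphav iota e f.
Hypothesis alpha_alphav : forall i, alpha i (alphav i) = 2.
Variables (M : lmodType C) (rho : g -> M -> M).
Hypothesis rhoM : is_module rho.

Notation wt := (weight_space rho iota).
Notation rs := (root_space iota).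

Definition is_weight mu := exists2 v, wt mu v & v <> 0.

Definition string_bounded (a : dual C h) :=
  forall mu, exists N, forall n, (N <= n)%N -> ~ is_weight (mu + a *+ n).

Definition weight_spanned := forall v, lin_span [set x | exists mu, wt mu x] v.

Definition reflection i (mu : dual C h) := mu - mu (alphav i) *: alpha i.

Lemma reflection_linear i : linear (reflection i).
Proof.
move=> a u v; rewrite /reflection add_lfunE scale_lfunE scalerDl opprD addrACA.
by rewrite scalerBr scalerA.
Qed.

Lemma reflection_alphav i mu : reflection i mu (alphav i) = - mu (alphav i).
Proof.
rewrite /reflection add_lfunE opp_lfunE scale_lfunE alpha_alphav.
by rewrite -[_ *: _]/(_ * _); ring.
Qed.

Lemma reflectionK i : involutive (reflection i).
Proof.
move=> mu.
by rewrite [LHS]/reflection reflection_alphav scaleNr opprK subrK.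
Qed.

Lemma reflection_simple i : reflection i (alpha i) = - alpha i.
Proof.
rewrite /reflection alpha_alphav -[X in X - _]scale1r -scalerBl -scaleN1r.
by congr (_ *: _); ring.
Qed.

Lemma root_triple a x y t : rs a x -> rs (- a) y -> lie x y = iota t ->
  a t = 2 ->
  sl2_triple (rho x) (rho y) (rho (iota t)).
Proof.
have [ll lr lb] := rhoM; move=> xa ya xy a2; split; try exact: lr.
- by move=> v; rewrite -xy lb addrC subrK.
- move=> c v vc; have /eqP := lb (iota t) x v.
  by rewrite xa a2 (linZ (ll v)) vc (linZ (lr x)) eq_sym subr_eq -scalerDl addrC => /eqP.
- move=> c v vc; have /eqP := lb (iota t) y v.
  rewrite ya opp_lfunE a2 (linZ (ll v)) vc (linZ (lr y)) eq_sym subr_eq -scalerDl addrC.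
  by move/eqP.
Qed.

Lemma simple_triple i : sl2_triple (rho (e i)) (rho (f i)) (rho (iota (alphav i))).
Proof.
case: rels => _ ef te tf _; apply: (@root_triple (alpha i)) => //.
- by move=> t; rewrite tf opp_lfunE.
- by rewrite ef eqxx.
Qed.

Lemma string_nilpotent a x : weight_spanned -> rs a x -> string_bounded a ->
  locally_nilpotent (rho x).
Proof.
have [ll lr lb] := rhoM; move=> sp xa ba v.
apply: (lin_span_min (W := [set w | exists n, iter n (rho x) w = 0])) (sp v) =>
  [|w [mu wm]] /=.
  split=> [|c u w [m mu] [n nw]]; first by exists 0%N.
  exists (m + n)%N; rewrite (iter_linear (m + n) (lr x)) (iter_zero_le (lr x)
    (leq_addr _ _) mu).
  by rewrite (iter_zero_le (lr x) (leq_addl _ _) nw) scaler0 addr0.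
have [N bN] := ba mu; exists N; apply: contrapT => nz.
by apply: (bN N (leqnn N)); exists (iter N (rho x) w) => //;
  exact: iter_rho_weight.
Qed.

Hypothesis nilp_e : forall i, locally_nilpotent (rho (e i)).
Hypothesis nilp_f : forall i, locally_nilpotent (rho (f i)).

(** For $\mu(\alpha_i^\vee)=n\ge 0$ the operator $f_i^n$ is injective on the weight space of [mu]
    and lands in the reflected one; for a negative value, $e_i$ replaces $f_i$. *)
Lemma weight_reflection i mu : is_weight mu -> is_weight (reflection i mu).
Proof.
move=> [v vm v0]; have t := simple_triple i.
case: rels => _ _ te tf _.
have [z muz] := weight_int t v0 (vm (alphav i)) (nilp_e i) (nilp_f i).
have ea : rs (alpha i) (e i) by move=> t'; rewrite te.
have fa : rs (- alpha i) (f i) by move=> t'; rewrite tf opp_lfunE.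
case: z muz => n muz.
  exists (iter n (rho (f i)) v).
    have := iter_rho_weight rhoM n fa vm.
    by rewrite /reflection muz mulNrn scaler_nat.
  move=> Fv; apply: v0; apply: (iterF_inj (j := n) (n :=
    n) t _ (nilp_e i v)) => //.
  by rewrite vm muz.
exists (iter n.+1 (rho (e i)) v).
  have := iter_rho_weight rhoM n.+1 ea vm.
  by rewrite /reflection muz NegzE rmorphN /= scaleNr opprK scaler_nat.
move=> Ev; apply: v0; apply: (iterE_inj (j := n.+1) (n :=
  n.+1) t _ (nilp_f i v)) => //.
by rewrite vm muz NegzE rmorphN.
Qed.

Lemma string_bounded_reflection i a : string_bounded a ->
  string_bounded (reflection i a).
Proof.
move=> ba mu; have [N bN] := ba (reflection i mu); exists N => n Nn.
move/(weight_reflection i); have lr := reflection_linear i.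
by rewrite (linD lr) -scaler_nat (linZ lr) reflectionK scaler_nat; exact: bN.
Qed.

Lemma is_weight_string_int i mu : is_weight mu ->
  exists z : int, mu (alphav i) = z%:~R.
Proof.
case=> v vm v0.
have [z muz] := weight_int (simple_triple i) v0 (vm (alphav i)) (nilp_e i) (nilp_f i).
by exists z.
Qed.

End IntegrableModules.

(** * Local nilpotency of the adjoint action, and the root spaces of zero and of the simple roots *)

Section Strings.
Variables (C : numClosedFieldType) (l : nat) (A : 'M[int]_l).
Variables (h : vectType C) (alpha : 'I_l -> dual C h) (alphav : 'I_l -> h).
Variables (g : lieAlgType C) (iota : {linear h -> g}) (e f : 'I_l -> g).
Hypothesis rels : KM_relations A alpha alphav iota e f.
Hypothesis gen : forall s : set g, is_subalgebra s -> (forall t, s (iota t)) ->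
  (forall i, s (e i)) -> (forall i, s (f i)) -> s = setT.
Hypothesis alpha_alphav : forall i, alpha i (alphav i) = 2.
Variable cf : 'I_l -> dual C h -> C.
Hypothesis cf_lin : forall i, linear (cf i : dual C h -> C^o).
Hypothesis cf_alpha : forall i j, cf i (alpha j) = (i == j)%:R.

Notation ww := (word_weight alpha).
Notation rs := (root_space iota).
Notation refl := (reflection alpha alphav).

Lemma cf_string j i mu n : cf j (mu + alpha i *+ n) = cf j mu + (j == i)%:R * n%:R.
Proof. by rewrite (linD (cf_lin j)) -scaler_nat (linZ (cf_lin j)) cf_alpha mulrC. Qed.

(** Checked on generators: the Serre relations settle the [e j], two brackets kill [h], and three
    kill [f i], which passes through $\alpha_i^\vee$ and a multiple of $e_i$. *)
Lemma ad_e_nilpotent i : locally_nilpotent (lie (e i)).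
Proof.
have [tt ef te tf serre] := rels;
  have lE := lie_linearr (e i) : linear (lie (e i)).
have et t : lie (e i) (iota t) = - alpha i t *: e i by rewrite lieC te scaleNr.
have := gen (ad_nilpotent_subalgebra (e i)) => all_nilp x.
have : [set: g] x by []. rewrite -all_nilp => [//|t|j|j] /=.
- by exists 2%N; rewrite /= et (linZ lE) lie_alt scaler0.
- have [->|ij] := eqVneq i j; first by exists 1%N; rewrite /= lie_alt.
  by have [E _] := serre i j ij; exists `|(1 - A i j)%R|%N.
- exists 3%N; rewrite /= ef; case: ifP => _; last by rewrite !(lin0 lE).
  by rewrite et (linZ lE) lie_alt scaler0.
Qed.

Lemma ad_f_nilpotent i : locally_nilpotent (lie (f i)).
Proof.
have [tt ef te tf serre] := rels;
  have lE := lie_linearr (f i) : linear (lie (f i)).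
have ft t : lie (f i) (iota t) = alpha i t *: f i
  by rewrite lieC tf scaleNr opprK.
have := gen (ad_nilpotent_subalgebra (f i)) => all_nilp x.
have : [set: g] x by []. rewrite -all_nilp => [//|t|j|j] /=.
- by exists 2%N; rewrite /= ft (linZ lE) lie_alt scaler0.
- exists 3%N; rewrite /= [lie (f i) (e j)]lieC ef; case: ifP => _;
  last by rewrite oppr0 !(lin0 lE).
  by rewrite (linN lE) ft !(linN lE, linZ lE) lie_alt scaler0 oppr0.
- have [->|ij] := eqVneq i j; first by exists 1%N; rewrite /= lie_alt.
  by have [_ E] := serre i j ij; exists `|(1 - A i j)%R|%N.
Qed.

Notation adm := (@lie_module C g).
Notation is_root0 := (is_weight iota (@lie C g)).

Lemma triangular_gen_has_weight x : triangular_gen iota e f x ->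
  exists mu, rs mu x.
Proof.
have [tt ef te tf serre] := rels.
case=> [] [[t ->]|[i [s ->]]].
- by exists 0; exact: (iota_weight rels).
- by exists (ww (i :: s)) => t; rewrite (lie_mon_weight te).
- exists 0 => t'; rewrite (linN (lie_linearr _)) tt oppr0 zero_lfunE scale0r //.
- exists (- ww (i :: s)) => t; rewrite opp_lfunE scaleNr.
  have nuf t' j : lie (- iota t') (f j) = alpha j t' *: f j.
    by rewrite (linN (lie_linearl _)) tf scaleNr opprK.
  by rewrite -(lie_mon_weight nuf) (linN (lie_linearl _)) opprK.
Qed.

Lemma root_classification a : is_root0 a ->
  [\/ a = 0, exists s, [/\ s != [::], a = ww s & forall i, all (pred1 i) s ->
    s = [:: i]]
    | exists s, [/\ s != [::], a = - ww s & forall i, all (pred1 i) s ->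
      s = [:: i]]].
Proof.
case=> x xa x0.
have [y [yG ya y0]] := weight_span_nonzero adm triangular_gen_has_weight
  (triangular_span rels gen x) xa x0.
case: (triangular_gen_weight rels yG ya y0) => [[-> _]|[s [s0 -> sE]]|[s [s0 ->
  sE]]].
- by constructor 1.
- by constructor 2; exists s; split=> // i /sE[].
- by constructor 3; exists s; split=> // i /sE[].
Qed.

(** A nonempty word has nonzero weight, as the coefficient of its first letter shows; only [h]
    remains in weight zero. *)
Lemma root_space0 x : rs 0 x -> exists t, x = iota t.
Proof.
move=> x0; have := weight_span adm triangular_gen_has_weight (triangular_span
  rels gen x) x0.
apply: (lin_span_min (W := [set x | exists t, x = iota t])).
  split=> [|c u v [t ->] [t' ->]]; first by exists 0; rewrite linear0.
  by exists (c *: t + t'); rewrite linearP.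
have no s : s != [::] -> ww s <> 0.
  case: s => // i s _ /(congr1 (cf i));
    rewrite (cf_word cf_lin cf_alpha) (lin0 (cf_lin i)) /= eqxx => /eqP.
  by rewrite pnatr_eq0.
move=> y [yG y0] /=; have [->|/eqP yn] := eqVneq y 0; first by exists 0;
  rewrite linear0.
case: (triangular_gen_weight rels yG y0 yn) =>
  [[_ //]|[s [s0 sE _]]|[s [s0 sE _]]].
- by case: (no s).
- by case: (no s) => //; apply/eqP; rewrite -oppr_eq0 -sE.
Qed.

(** Comparing coefficients, a word of weight [alpha i] uses only the letter [i], and brackets of
    several copies of [e i] vanish; so [e i] alone spans the root space, and likewise for [f i]. *)
Lemma simple_root_spaces i :
  (forall x, rs (alpha i) x -> exists c, x = c *: e i) /\
  (forall x, rs (- alpha i) x -> exists c, x = c *: f i).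
Proof.
have line (u : g) : is_subspace [set x | exists c : C, x = c *: u].
  split=> [|c x y [d ->] [d' ->]]; first by exists 0; rewrite scale0r.
  by exists (c * d + d'); rewrite scalerDl scalerA.
have wordE s : alpha i = ww s -> all (pred1 i) s.
  move=> sE; apply/allP => j js /=; have := congr1 (cf j) sE.
  rewrite cf_alpha (cf_word cf_lin cf_alpha) => /eqP;
    rewrite eqr_nat eq_sym => /eqP jE.
  by move: js; rewrite -has_pred1 has_count jE; case: eqP.
have a0 : alpha i != 0.
  apply/eqP => /(congr1 (cf i));
    rewrite cf_alpha eqxx (lin0 (cf_lin i)) => /eqP.
  by rewrite oner_eq0.
have mixed s : s != [::] -> alpha i <> - ww s.
  case: s => // j s _ /(congr1 (cf j));
    rewrite (linN (cf_lin j)) (cf_word cf_lin cf_alpha) cf_alpha.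
  move/eqP; rewrite -addr_eq0 -natrD pnatr_eq0 /= eqxx; lia.
split=> x xa; have := weight_span adm triangular_gen_has_weight
  (triangular_span rels gen x) xa;
  apply: (lin_span_min (line _)) => y [yG ya] /=;
  (have [->|/eqP yn] := eqVneq y 0; first by exists 0; rewrite scale0r);
  case: (triangular_gen_weight rels yG ya yn) =>
    [[aE _]|[s [s0 sE yE]]|[s [s0 sE yE]]].
- by rewrite aE eqxx in a0.
- by have [_ ->] := yE i (wordE s sE); exists 1; rewrite scale1r.
- by case: (mixed s).
- by rewrite -oppr_eq0 aE eqxx in a0.
- by case: (mixed s) => //; rewrite -sE opprK.
- have /yE[_ ->] : all (pred1 i) s by apply: wordE;
  rewrite -[ww s]opprK -sE opprK.
  by exists 1; rewrite scale1r.
Qed.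

Lemma ad_weight_spanned : weight_spanned iota (@lie C g).
Proof.
move=> x; apply: lin_span_min (triangular_span rels gen x).
  exact: lin_span_subspace.
by move=> y /triangular_gen_has_weight ym; exact: lin_span_sub.
Qed.

End Strings.

(** Turns comparisons of coefficients into equations between natural numbers. *)
Lemma natr_diff_eq (C : numDomainType) (x y z w : nat) :
  x%:R - y%:R = z%:R - w%:R :> C -> (x + w = z + y)%N.
Proof.
move/eqP; rewrite subr_eq addrAC eq_sym subr_eq -!natrD eqr_nat => /eqP ->.
by [].
Qed.

(** * Bounds on strings in the direction of a simple root *)

Section StringBounds.
Variables (C : numClosedFieldType) (l : nat) (A : 'M[int]_l).
Variables (h : vectType C) (alpha : 'I_l -> dual C h) (alphav : 'I_l -> h).
Variables (g : lieAlgType C) (iota : {linear h -> g}) (e f : 'I_l -> g).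
Hypothesis rels : KM_relations A alpha alphav iota e f.
Hypothesis gen : forall s : set g, is_subalgebra s -> (forall t, s (iota t)) ->
  (forall i, s (e i)) -> (forall i, s (f i)) -> s = setT.
Hypothesis alpha_alphav : forall i, alpha i (alphav i) = 2.
Variable cf : 'I_l -> dual C h -> C.
Hypothesis cf_lin : forall i, linear (cf i : dual C h -> C^o).
Hypothesis cf_alpha : forall i j, cf i (alpha j) = (i == j)%:R.

Notation ww := (word_weight alpha).
Notation rs := (root_space iota).
Notation refl := (reflection alpha alphav).
Notation is_root0 := (is_weight iota (@lie C g)).

(** The zero weight is given the empty word, so that all signs are treated uniformly. *)
Lemma root_word a : is_root0 a -> exists s,
  (a = ww s \/ a = - ww s) /\ forall i, all (pred1 i) s -> (size s <= 1)%N.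
Proof.
case/(root_classification rels gen) => [->|[s [_ aE sE]]|[s [_ aE sE]]].
- by exists [::]; split=> //; left; rewrite /word_weight big_nil.
- by exists s; split=> [|i /sE ->]; first by left.
- by exists s; split=> [|i /sE ->]; first by right.
Qed.

(** A string that meets some weight may be started there; one that meets none is trivially
    bounded. *)
Lemma string_bounded_shift (M : lmodType C) (rho : g -> M -> M) a :
  (forall mu, is_weight iota rho mu ->
     exists N, forall n, (N <= n)%N -> ~ is_weight iota rho (mu + a *+ n)) ->
  string_bounded iota rho a.
Proof.
move=> ba mu; have [[n0 /ba[N bN]]|no] :=
  pselect (exists n, is_weight iota rho (mu + a *+ n)).
  exists (n0 + N)%N => n n0n; have := bN (n - n0)%N.
  by rewrite -addrA -mulrnDr subnKC; [apply|]; lia.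
by exists 0%N => n _ wn; apply: no; exists n.
Qed.

(** The coefficient of any $j\ne i$ is constant along the string and fixes the sign of the roots.
    For negative roots the coefficient of $i$ then bounds the string; for positive ones the
    reflected string, which descends, is bounded in the same way. *)
Lemma root_string_bounded i : string_bounded iota (@lie C g) (alpha i).
Proof.
apply: string_bounded_shift => a0 a0w.
have cfw j s : cf j (ww s) = (count_mem j s)%:R := cf_word cf_lin cf_alpha j s.
have reflw a : is_root0 a -> is_root0 (refl i a).
  by apply: (weight_reflection rels alpha_alphav (lie_module g));
    [exact: (ad_e_nilpotent rels gen)|exact: (ad_f_nilpotent rels gen)].
have cfr j a : j != i -> cf j (refl i a) = cf j a.
  move=> /negPf ji; rewrite (linB (cf_lin j)) (linZ (cf_lin j)) cf_alpha ji.
  by rewrite scaler0 subr0.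
have cfs := cf_string cf_lin cf_alpha.
have [s0 [a0E all0]] := root_word a0w.
have [[j ji js]|no_j] := pselect (exists2 j, j != i & j \in s0).
  have cj : (0 < count_mem j s0)%N by rewrite -has_count has_pred1.
  case: a0E => a0E.
    have [s1 [a1E _]] := root_word (reflw _ a0w).
    exists (count_mem i s1).+1 => n n1 /reflw w.
    have := cfr _ a0 ji; rewrite a0E cfw => c0.
    (* The reflection fixes the positive coefficient of [j], so the reflected root is again
       positive. *)
    have a1 : refl i a0 = ww s1.
      case: a1E => // a1E; have := cfr _ a0 ji;
        rewrite a1E (linN (cf_lin j)) a0E !cfw.
      rewrite -[- _]add0r -[X in _ = X]subr0 => /(@natr_diff_eq C 0 _ _ 0); lia.
    have E : refl i (a0 + alpha i *+ n) + alpha i *+ n = ww s1.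
      have lr := reflection_linear alpha alphav i.
      rewrite (linD lr) a1 -scaler_nat (linZ lr) (reflection_simple alpha_alphav).
      by rewrite scalerN -addrA addNr addr0.
    have [s [aE _]] := root_word w.
    have Ej := congr1 (cf j) E; have Ei := congr1 (cf i) E.
    have E1 := congr1 (cf j) a1; rewrite cfr // a0E in E1.
    case: aE => aE; rewrite aE !cfs ?(linN (cf_lin _)) !cfw in Ej Ei E1.
      move: Ei; rewrite eqxx mul1r -natrD => /eqP; rewrite eqr_nat => /eqP; lia.
    move: Ej E1; rewrite (negPf ji) mul0r addr0 => <- /eqP.
    by rewrite -addr_eq0 -natrD pnatr_eq0; lia.
  exists (count_mem i s0).+1 => n n1 w; have [s [aE _]] := root_word w.
  have Ej := cfs j i a0 n; have Ei := cfs i i a0 n.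
  case: aE => aE; rewrite aE a0E ?(linN (cf_lin _)) !cfw in Ej Ei.
    move: Ej; rewrite (negPf ji) mul0r addr0 => /eqP.
    by rewrite -addr_eq0 -natrD pnatr_eq0; lia.
  move: Ei; rewrite eqxx mul1r addrC -[- _]add0r =>
    /(@natr_diff_eq C 0 _ _ _). lia.
have alls s : (forall j, j != i -> count_mem j s = 0%N) -> all (pred1 i) s.
  move=> c0; apply/allP => j js /=; apply/negP => /negP/c0.
  by move: js; rewrite -has_pred1 has_count => + jE; rewrite jE.
have c0 j : j != i -> count_mem j s0 = 0%N.
  move=> ji; apply/eqP; rewrite -leqn0 leqNgt -has_count has_pred1;
    apply/negP => js.
  by apply: no_j; exists j.
(* Both ends of the string now lie in $\{-\alpha_i,0,\alpha_i\}$, so they are at most two steps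
   apart. *)
exists 3%N => n n3 w; have [s [aE sz]] := root_word w.
have cs j : j != i -> count_mem j s = 0%N.
  move=> ji; have := cfs j i a0 n; rewrite (negPf ji) mul0r addr0.
  case: aE a0E => -> [] ->; rewrite ?(linN (cf_lin _)) !cfw c0 // ?oppr0 =>
    /eqP;
    by rewrite ?oppr_eq0 pnatr_eq0 => /eqP.
have := leq_trans (count_size (pred1 i) s) (sz i (alls _ cs)).
have := leq_trans (count_size (pred1 i) s0) (all0 i (alls _ c0)).
have := cfs i i a0 n; rewrite eqxx mul1r.
case: aE a0E => -> [] ->; rewrite ?(linN (cf_lin _)) !cfw.
- by rewrite -natrD => /eqP; rewrite eqr_nat => /eqP; lia.
- rewrite [- _ + _]addrC -[LHS]subr0 => /(@natr_diff_eq C _ 0 _ _). lia.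
- by rewrite -natrD -[- _]add0r -[RHS]subr0 => /(@natr_diff_eq C 0 _ _ 0); lia.
- by rewrite [- _ + _]addrC -[LHS]add0r => /(@natr_diff_eq C 0 _ _ _); lia.
Qed.

Variables (V : lmodType C) (rho : g -> V -> V) (lambda : dual C h) (v0 : V).
Hypothesis rhoM : is_module rho.
Hypothesis v0_e : forall i, rho (e i) v0 = 0.
Hypothesis v0_weight : weight_space rho iota lambda v0.
Hypothesis v0_gen : Ug_span rho v0 = setT.

Definition lowering_gen : set V :=
  [set v | exists s, v = foldr (fun i => rho (f i)) v0 s].

Lemma lowering_weight s :
  weight_space rho iota (lambda - ww s) (foldr (fun i => rho (f i)) v0 s).
Proof.
elim: s => [|i s IHs] /=; first by rewrite /word_weight big_nil subr0.
rewrite word_weight_cons opprD [- alpha i + _]addrC addrA.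
exact: (rho_weight rhoM (f_weight rels i) IHs).
Qed.

(** The span is stable under the generators: [e i] moves past each [f j] at the cost of a term in
    [h], which acts by a scalar, until it kills [v0]. *)
Lemma lowering_span v : lin_span lowering_gen v.
Proof.
have [_ ef _ _ _] := rels; have [ll lr lb] := rhoM.
have sub := lin_span_subspace lowering_gen.
have st t w : lin_span lowering_gen w -> lin_span lowering_gen (rho (iota t) w).
  apply: (lin_span_image (lr _)) => _ [s ->]; rewrite lowering_weight.
  by apply: subspaceZ => //; apply: lin_span_sub; exists s.
have sf i w : lin_span lowering_gen w -> lin_span lowering_gen (rho (f i) w).
  by apply: (lin_span_image (lr _)) => _ [s ->]; apply: lin_span_sub;
    exists (i :: s).
have se i w : lin_span lowering_gen w -> lin_span lowering_gen (rho (e i) w).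
  apply: (lin_span_image (lr _)) => _ [s ->].
  elim: s => [|j s IHs] /=; first by rewrite v0_e; exact: lin_span0.
  have /eqP := lb (e i) (f j) (foldr (fun i => rho (f i)) v0 s).
  rewrite eq_sym subr_eq => /eqP ->; apply: subspaceD => //; last exact: sf.
  rewrite ef; case: ifP => _; last by rewrite (lin0 (ll _)); exact: lin_span0.
  by apply: st; apply: lin_span_sub; exists s.
have stab := generated_stable gen rhoM sub st se sf.
have : Ug_span rho v0 v by rewrite v0_gen.
case=> ps ->; elim: ps => [|[c xs] ps IHps]; first by rewrite big_nil;
  exact: lin_span0.
rewrite big_cons; apply: (proj2 sub) IHps => /=.
elim: xs => [|x xs IHxs] /=; last exact: stab.
by apply: lin_span_sub; exists [::].
Qed.

Lemma highest_weight_spanned : weight_spanned iota rho.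
Proof.
move=> v; apply: lin_span_min (lowering_span v); first exact: lin_span_subspace.
by move=> _ [s ->]; apply: lin_span_sub; exists (lambda - ww s);
  exact: lowering_weight.
Qed.

(** Every weight is [lambda] minus the weight of a word, and each step along the string lowers the
    number of letters [i] in that word. *)
Lemma highest_weight_string_bounded i : string_bounded iota rho (alpha i).
Proof.
have wE mu : is_weight iota rho mu -> exists s, mu = lambda - ww s.
  case=> v vm vn.
  have gw x : lowering_gen x -> exists mu, weight_space rho iota mu x.
    by case=> s ->; exists (lambda - ww s); exact: lowering_weight.
  have [_ [[s ->] ym yn]] := weight_span_nonzero rhoM gw (lowering_span v) vm vn.
  by exists s; apply: weight_uniq yn ym (lowering_weight s).
apply: string_bounded_shift => mu /wE[s0 ->];
  exists (count_mem i s0).+1 => n n1 /wE[s].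
have cfw s' : cf i (ww s') = (count_mem i s')%:R :=
  cf_word cf_lin cf_alpha i s'.
rewrite -addrA => /addrI/(congr1 (cf i)).
rewrite (linD (cf_lin i)) !(linN (cf_lin i)) !cfw -scaler_nat (linZ (cf_lin i))
  cf_alpha eqxx.
rewrite [_ *: _]mulr1 addrC -[RHS]add0r => /(@natr_diff_eq C _ _ 0 _); lia.
Qed.

End StringBounds.

(** Serves to evaluate [nu], whose body applies [linfun] to plain functions. *)
Lemma linfun_linear (C : fieldType) (U W : vectType C) (F : U -> W) :
  linear F -> linfun F =1 F.
Proof.
move=> lF u; pose G : {linear U -> W} :=
  HB.pack F (GRing.isLinear.Build _ _ _ _ F lF).
by rewrite -[F]/(G : U -> W) lfunE.
Qed.

(** * Real roots *)

Section RealRoots.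
Variables (C : numClosedFieldType) (l : nat) (A : 'M[int]_l).
Variables (h : vectType C) (alpha : 'I_l -> dual C h) (alphav : 'I_l -> h).
Variables (g : lieAlgType C) (iota : {linear h -> g}) (e f : 'I_l -> g).
Hypothesis rels : KM_relations A alpha alphav iota e f.
Hypothesis gen : forall s : set g, is_subalgebra s -> (forall t, s (iota t)) ->
  (forall i, s (e i)) -> (forall i, s (f i)) -> s = setT.
Hypothesis pairing : forall i j, alpha j (alphav i) = (A i j)%:~R.
Hypothesis alpha_alphav : forall i, alpha i (alphav i) = 2.
Variable cf : 'I_l -> dual C h -> C.
Hypothesis cf_lin : forall i, linear (cf i : dual C h -> C^o).
Hypothesis cf_alpha : forall i j, cf i (alpha j) = (i == j)%:R.
Variable B : {biscalar g}.
Hypothesis standard : is_standard_form iota B A alpha.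
Variables (V : lmodType C) (rho : g -> V -> V).
Hypothesis rhoM : is_module rho.
Hypothesis nilp_e : forall i, locally_nilpotent (rho (e i)).
Hypothesis nilp_f : forall i, locally_nilpotent (rho (f i)).
Hypothesis V_spanned : weight_spanned iota rho.
Hypothesis V_bounded : forall i, string_bounded iota rho (alpha i).

Notation ww := (word_weight alpha).
Notation rs := (root_space iota).
Notation refl := (reflection alpha alphav).
Notation is_root0 := (is_weight iota (@lie C g)).
Notation df := (dual_form iota B).

Implicit Types (a b mu : dual C h) (x y : g).

Let adm := @lie_module C g.
Let ade i : locally_nilpotent (lie (e i)). Proof. exact: (ad_e_nilpotent rels gen). Qed.
Let adf i : locally_nilpotent (lie (f i)). Proof. exact: (ad_f_nilpotent rels gen). Qed.
Let rl i : linear (refl i). Proof. exact: reflection_linear. Qed.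
Let rK i : involutive (refl i). Proof. exact: reflectionK. Qed.
Let Bl y : linear (B^~ y : g -> C^o). Proof. by move=> a u v;
  rewrite linearPl. Qed.
Let Br y : linear (B y : g -> C^o). Proof. by move=> a u v;
  rewrite linearPr. Qed.

(** The bracket has weight zero, hence lies in [h], and invariance gives $([x,y]\mid
    t')=(x\mid[y,t'])=a(t')(x\mid y)$. *)
Lemma opposite_bracket a x y : rs a x -> rs (- a) y ->
  exists2 t, lie x y = iota t & forall t', B (iota t) (iota t') = B x y * a t'.
Proof.
case: standard => _ Binv _ _ _ xa ya.
have xy0 : rs 0 (lie x y) by have := rho_weight adm xa ya; rewrite addNr.
have [t xy] := root_space0 rels gen cf_lin cf_alpha xy0; exists t => // t'.
rewrite -xy Binv lieC ya opp_lfunE scaleNr opprK (linZ (Br _)).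
by rewrite [_ *: _]mulrC.
Qed.

(** Here $\nu^{-1}(a)=t/B(x,y)$, so $(a\mid a)=B(t,t)/B(x,y)^2=a(t)/B(x,y)$. In particular $a(t)\ne
    0$ for a real root. *)
Lemma dual_form_bracket a x y t : rs a x -> rs (- a) y -> lie x y = iota t ->
  (forall t', B (iota t) (iota t') = B x y * a t') -> B x y != 0 ->
  a t = df a a * B x y.
Proof.
case: standard => _ _ Bnd _ _ xa ya xy tE b0.
have lB u : linear (fun w => B (iota u) (iota w) : C^o).
  by move=> c v w; rewrite (linearP iota); exact: Br.
have nuE u u' : nu iota B u u' = B (iota u) (iota u').
  rewrite /nu linfun_linear => [|c v w]; first by rewrite linfun_linear.
  apply/lfunP => w'; rewrite add_lfunE scale_lfunE !linfun_linear //.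
  by rewrite (linearP iota); exact: Bl.
(* Nondegeneracy on [h] makes [nu] injective, so that [nu^-1] is a genuine left inverse. *)
have ker0 : lker (nu iota B) == 0%VS.
  apply/lker0P => u v uv; apply/subr0_eq/Bnd => u'.
  by rewrite -nuE linearB /= uv subrr zero_lfunE.
have ta : (nu iota B)^-1%VF a = (B x y)^-1 *: t.
  rewrite -(lker0_lfunK ker0 ((B x y)^-1 *: t)); congr (_ _).
  apply/lfunP => u; rewrite nuE linearZ (linZ (Bl _)) tE [_ *: _]mulrA mulVf // mul1r.
  by [].
rewrite /dual_form ta linearZ (linZ (Bl _)) (linZ (Br _)) tE.
by rewrite -![_ *: _]/(_ * _); field.
Qed.

Definition root_pair a x y := [/\ rs a x, rs (- a) y, B x y != 0,
  forall x', rs a x' -> exists c, x' = c *: x &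
  forall y', rs (- a) y' -> exists c, y' = c *: y].

(** Collects the facts to be transported, with both signs, so that the property is stable under
    negation and simple reflections. *)
Definition sl2_root a := (exists x y, root_pair a x y) /\
  [/\ string_bounded iota (@lie C g) a, string_bounded iota (@lie C g) (- a),
      string_bounded iota rho a & string_bounded iota rho (- a)].

Lemma root_pair_opp a x y : root_pair a x y -> root_pair (- a) y x.
Proof. by case: standard => Bsym _ _ _ _ [? ? ? ? ?]; split;
  rewrite ?opprK // Bsym. Qed.

Lemma sl2_root_opp a : sl2_root a -> sl2_root (- a).
Proof.
case=> [[x [y xy]] [? ? ? ?]]; split; last by split; rewrite ?opprK.
by exists y, x; exact: root_pair_opp.
Qed.

(** If [e i] and [f i] were orthogonal, $\alpha_i^\vee=[e_i,f_i]$ would lie in the radical of the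
    form on [h]. The bounds for [- alpha i] are those for [alpha i], reflected. *)
Lemma sl2_root_simple i : sl2_root (alpha i).
Proof.
have [_ ef _ _ _] := rels.
split; last first.
  split; rewrite -?(reflection_simple alpha_alphav).
  - exact: (root_string_bounded rels gen alpha_alphav cf_lin cf_alpha).
  - apply: (string_bounded_reflection rels alpha_alphav adm) => //.
    exact: (root_string_bounded rels gen alpha_alphav cf_lin cf_alpha).
  - exact: V_bounded.
  - exact: (string_bounded_reflection rels alpha_alphav rhoM).
have [de df] := simple_root_spaces rels gen cf_lin cf_alpha i.
have ei := e_weight rels i; have fi := f_weight rels i.
exists (e i), (f i); split=> //.
apply/eqP => B0; have [t xy tE] := opposite_bracket ei fi.
case: standard => _ _ Bnd _ _.
have : alphav i = 0.
  apply: Bnd => t'; have := tE t'; rewrite B0 mul0r => <-.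
  by rewrite -xy ef eqxx.
move/(congr1 (alpha i)); rewrite linear0 alpha_alphav => /eqP.
by rewrite pnatr_eq0.
Qed.

(** The maps $e_i^n$ and $f_i^n$ go injectively back and forth between the root spaces of [a] and
    [refl i a], and between those of their opposites. Their composites on the lines of [a] and [- a]
    are nonzero scalars, whence one-dimensionality; invariance turns the new pairing into $\pm
    c\,B(x,y)$ with $c\ne 0$. *)
Lemma root_pair_reflection i a x y n : a (alphav i) = - n%:R ->
  root_pair a x y ->
  root_pair (refl i a) (iter n (lie (e i)) x) (iter n (lie (f i)) y).
Proof.
case: (standard) => Bsym Binv _ _ _ an [xa ya b0 dx dy].
have t := simple_triple rels alpha_alphav adm i.
set E := lie (e i) in t *; set F := lie (f i) in t *.
have lEn : linear (iter n E) by apply: iter_linear; exact: lie_linearr.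
have lFn : linear (iter n F) by apply: iter_linear; exact: lie_linearr.
have ra : refl i a = a + alpha i *+ n.
  by rewrite /reflection an scaleNr opprK scaler_nat.
have rV : refl i a (alphav i) = n%:R
  by rewrite (reflection_alphav alpha_alphav) an opprK.
have up b z : rs b z -> rs (b + alpha i *+ n) (iter n E z).
  exact: (iter_rho_weight adm n (e_weight rels i)).
have down b z : rs b z -> rs (b - alpha i *+ n) (iter n F z).
  by rewrite -mulNrn; exact: (iter_rho_weight adm n (f_weight rels i)).
have injE b z : rs b z -> b (alphav i) = - n%:R -> iter n E z = 0 -> z = 0.
  move=> zb bn; apply: (iterE_inj (n := n) t _ (adf i z)) => //.
  by rewrite zb bn.
have injF b z : rs b z -> b (alphav i) = n%:R -> iter n F z = 0 -> z = 0.
  move=> zb bn; apply: (iterF_inj (n := n) t _ (ade i z)) => //.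
  by rewrite zb bn.
have Ex := up _ _ xa; have Fy := down _ _ ya; rewrite -ra in Ex.
rewrite -opprD -ra in Fy.
have NrV : (- refl i a) (alphav i) = - n%:R by rewrite opp_lfunE rV.
have NaV : (- a) (alphav i) = n%:R by rewrite opp_lfunE an opprK.
have x0 : x <> 0 by move=> x0; move: b0; rewrite x0 (lin0 (Bl _)) eqxx.
have y0 : y <> 0 by move=> y0; move: b0; rewrite y0 (lin0 (Br _)) eqxx.
have [c EFy] : exists c, iter n E (iter n F y) = c *: y.
  by apply: dy; have := up _ _ Fy; rewrite ra opprD -addrA addNr addr0.
have c0 : c != 0.
  apply/eqP => c0; apply: y0; apply: injF ya NaV _; apply: injE Fy NrV _.
  by rewrite EFy c0 scale0r.
have [d FEx] : exists d, iter n F (iter n E x) = d *: x.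
  by apply: dx; have := down _ _ Ex; rewrite ra addrK.
have d0 : d != 0.
  apply/eqP => d0; apply: x0; apply: injE xa an _; apply: injF Ex rV _.
  by rewrite FEx d0 scale0r.
split=> //.
- suff -> : B (iter n E x) (iter n F y) = (-1) ^+ n * c * B x y.
    by rewrite !mulf_neq0 // expf_neq0 // oppr_eq0 oner_eq0.
  have Eskew m u v : B (iter m E u) v = (-1) ^+ m * B u (iter m E v).
    elim: m u v => [|m IHm] u v; first by rewrite mul1r.
    rewrite iterS {1}/E lieC (linN (Bl _)) Binv IHm iterSr exprS.
    by rewrite mulN1r mulNr.
  by rewrite Eskew EFy (linZ (Br _)) [_ *: _]/(_ * _) mulrA.
- move=> x' x'a; have [k Fx'] : exists k, iter n F x' = k *: x.
    by apply: dx; have := down _ _ x'a; rewrite ra addrK.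
  exists (k / d); apply/subr0_eq; apply: (injF (refl i a)) => //.
    by apply: (subspaceB (weight_subspace iota adm _)) => //;
      apply: (subspaceZ _ (weight_subspace iota adm _)).
  by rewrite (linB lFn) (linZ lFn) FEx Fx' scalerA divfK // subrr.
- move=> y' y'a; have [k Ey'] : exists k, iter n E y' = k *: y.
    by apply: dy; have := up _ _ y'a; rewrite ra opprD -addrA addNr addr0.
  exists (k / c); apply/subr0_eq; apply: (injE (- refl i a)) => //.
    by apply: (subspaceB (weight_subspace iota adm _)) => //;
      apply: (subspaceZ _ (weight_subspace iota adm _)).
  by rewrite (linB lEn) (linZ lEn) EFy Ey' scalerA divfK // subrr.
Qed.

Lemma sl2_root_reflection i a : sl2_root a -> sl2_root (refl i a).
Proof.
case=> [[x [y xy]] [b1 b2 b3 b4]]; split; last first.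
  rewrite -(linN (rl i)).
  by split; [exact: (string_bounded_reflection rels alpha_alphav adm)
    |exact: (string_bounded_reflection rels alpha_alphav adm)
    |exact: (string_bounded_reflection rels alpha_alphav rhoM)
    |exact: (string_bounded_reflection rels alpha_alphav rhoM)].
have aw : is_root0 a.
  case: xy => xa _ b0 _ _; exists x => // x0.
  by move: b0; rewrite x0 (lin0 (Bl _)) eqxx.
(* When the pairing with $\alpha_i^\vee$ is nonnegative, the previous lemma is applied to [- a];
   [Negz n] stands for $-(n+1)$. *)
have [[] n az] := is_weight_string_int rels alpha_alphav adm ade adf i aw.
  have /(@root_pair_reflection i (- a) y x n) : (- a) (alphav i) = - n%:R.
    by rewrite opp_lfunE az.
  move/(_ (root_pair_opp xy)); rewrite (linN (rl i)) => /root_pair_opp.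
  by rewrite opprK => ?; eexists; eexists; eassumption.
by do 2 eexists; apply: (@root_pair_reflection i a x y n.+1).
Qed.

Lemma dual_formC a b : df a b = df b a.
Proof. by case: standard => Bsym _ _ _ _; exact: Bsym. Qed.

Lemma dual_form_linear b : linear (df^~ b : dual C h -> C^o).
Proof. by move=> c u v; rewrite /dual_form linearP (linearP iota);
  exact: Bl. Qed.

Lemma word_alphav i s : ww s (alphav i) = (\sum_(j <- s) A i j)%:~R.
Proof.
elim: s => [|j s IHs]; first by rewrite /word_weight !big_nil zero_lfunE.
by rewrite word_weight_cons add_lfunE IHs pairing big_cons rmorphD.
Qed.

Lemma dual_form_simple i s :
  df (alpha i) (ww s) = (\sum_(j <- s) A i j)%:~R * (df (alpha i) (alpha i) / 2).
Proof.
case: standard => _ _ _ pos cartan.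
elim: s => [|j s IHs].
  by rewrite dual_formC /word_weight !big_nil (lin0 (dual_form_linear _)) mul0r.
rewrite word_weight_cons dual_formC (linD (dual_form_linear _)) ![df _ (alpha
  i)]dual_formC IHs.
rewrite big_cons rmorphD /= cartan.
move: (df _ _) (df _ (alpha j)) (lt0r_neq0 (pos i)) => d d' d0.
by field.
Qed.

Lemma dual_form_word s b : df (ww s) b = \sum_(i <- s) df (alpha i) b.
Proof.
elim: s => [|j s IHs]; first by rewrite /word_weight !big_nil (lin0 (dual_form_linear _)).
by rewrite word_weight_cons (linD (dual_form_linear _)) IHs big_cons.
Qed.

(** The coefficient [c] equals $2(\alpha_i\mid w)/(\alpha_i\mid\alpha_i)$, so the reflection is
    orthogonal. *)
Lemma dual_form_reflection i s : df (refl i (ww s)) (refl i (ww s)) = df (ww s) (ww s).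
Proof.
rewrite /reflection; set c := ww s (alphav i).
have ic : df (alpha i) (ww s) = c * (df (alpha i) (alpha i) / 2).
  by rewrite dual_form_simple /c word_alphav.
rewrite (linB (dual_form_linear _)) (linZ (dual_form_linear _)) ![df _ (_ - _)]dual_formC.
rewrite !(linB (dual_form_linear _)) !(linZ (dual_form_linear _)) [df (ww s)
  (alpha i)]dual_formC ic.
rewrite -![_ *: _]/(_ * _).
by move: (df (ww s) _) (df (alpha i) _) => d d'; field.
Qed.

Lemma height_word s : \sum_i cf i (ww s) = (size s)%:R.
Proof.
elim: s => [|j s IHs].
  by rewrite big1 // => i _; rewrite /word_weight big_nil (lin0 (cf_lin i)).
rewrite -[size _]/(size s).+1 -natr1 -IHs word_weight_cons.
under eq_bigr => i _ do rewrite (linD (cf_lin i)) cf_alpha.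
rewrite big_split /= addrC; congr (_ + _);
  rewrite (bigD1 j) //= eqxx big1 ?addr0 // => i /negPf ->.
by [].
Qed.

(* Induction on the height: a root of positive norm is simple or has its height
   lowered by some simple reflection. *)
Lemma real_word_sl2_root s : is_root0 (ww s) \/ is_root0 (- ww s) ->
  0 < df (ww s) (ww s) -> sl2_root (ww s).
Proof.
have [n] := ubnP (size s); elim: n s => [//|n IHn] s /ltnSE sn sw spos.
have cfw j s' : cf j (ww s') = (count_mem j s')%:R :=
  cf_word cf_lin cf_alpha j s'.
case: (standard) => _ _ _ apos _.
have signed b : is_root0 b \/ is_root0 (- b) -> exists s',
    (b = ww s' \/ b = - ww s') /\ forall i, all (pred1 i) s' ->
      (size s' <= 1)%N.
  case=> /(root_word rels gen)[s' [E s1]]; exists s'; split=> //.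
  by case: E => E; [right|left]; rewrite -?E ?opprK //; apply: oppr_inj.
(* Otherwise every letter pairs nonpositively with the root, and summing over the letters gives a
   norm at most zero. *)
have [i is_s zi] : exists2 i, i \in s & 0 < \sum_(j <- s) A i j.
  apply: contrapT => no; suff /le_gtF : df (ww s) (ww s) <= 0 by rewrite spos.
  rewrite dual_form_word big_seq; apply: sumr_le0 => i is_s.
  rewrite dual_form_simple; apply: mulr_le0_ge0;
    last by rewrite divr_ge0 ?ler0n // ltW.
  by rewrite lerz0 leNgt; apply/negP => zi; apply: no; exists i.
have [s_simple|] := boolP (all (pred1 i) s).
  have ci : (0 < count_mem i s)%N by rewrite -has_count has_pred1.
  have cj j : j != i -> count_mem j s = 0%N.
    move=> ji; apply/eqP; rewrite -leqn0 leqNgt -has_count has_pred1;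
      apply/negP => js.
    by move/allP: s_simple => /(_ _ js); rewrite /= (negPf ji).
  suff -> : ww s = alpha i by exact: sl2_root_simple.
  (* The word [s] could repeat [i]; the word supplied by the root structure has the same letter
     counts and length at most one. *)
  have [s' [sE s1]] := signed _ sw.
  have {}sE : ww s = ww s'.
    case: sE => // /(congr1 (cf i)); rewrite (linN (cf_lin i)) !cfw => /eqP.
    by rewrite -addr_eq0 -natrD pnatr_eq0; lia.
  have c' (j : 'I_l) : count_mem j s' = count_mem j s.
    by apply/eqP; rewrite -(eqr_nat C) -!cfw sE.
  have all' : all (pred1 i) s'.
    apply/allP => j js /=; apply/negP => /negP/cj; rewrite -c'.
    by move: js; rewrite -has_pred1 has_count => + jE; rewrite jE.
  have sz := s1 i all'; clear s1;
    case: s' all' sz sE c' => [_ _ _ /(_ i)|k [|? ?] //= all' _ -> _].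
    by move=> /= c0; rewrite -c0 in ci.
  by rewrite /word_weight big_seq1; move: all'; rewrite andbT => /eqP ->.
rewrite -has_predC => /hasP[j js /= ji].
have cj : (0 < count_mem j s)%N by rewrite -has_count has_pred1.
have reflw a : is_root0 a -> is_root0 (refl i a).
  exact: (weight_reflection rels alpha_alphav adm ade adf).
have rw : is_root0 (refl i (ww s)) \/ is_root0 (- refl i (ww s)).
  by rewrite -(linN (rl i)); case: sw => /reflw; [left|right].
have [s' [E _]] := signed _ rw.
(* The positive coefficient of $j\ne i$ is unchanged, so the reflected root stays positive. *)
have {}E : refl i (ww s) = ww s'.
  case: E => // /(congr1 (cf j));
    rewrite (linN (cf_lin j)) (linB (cf_lin j)) (linZ (cf_lin j)).
  rewrite cf_alpha (negPf ji) scaler0 subr0 !cfw => /eqP.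
  by rewrite -addr_eq0 -natrD pnatr_eq0; lia.
rewrite -[ww s](rK i) E; apply: sl2_root_reflection; apply: IHn.
(* The height drops by $w(\alpha_i^\vee)>0$, where $w$ is the weight of [s]. *)
- have := congr1 (fun a => \sum_k cf k a) E;
  rewrite /= height_word /reflection word_alphav.
  under eq_bigr => k _ do
    rewrite (linB (cf_lin k)) (linZ (cf_lin k)) cf_alpha -[_ *: _]/(_ * _).
  have delta : \sum_k (k == i)%:R = 1 :> C.
    by rewrite (bigD1 i) //= eqxx big1 ?addr0 // => k /negPf ->.
  rewrite sumrB height_word -mulr_sumr delta mulr1.
  case: (\sum_(_ <- s) _) zi => [m m0 /eqP|//].
  rewrite subr_eq -[_%:~R]/(m%:R) -natrD eqr_nat => /eqP; lia.
- by rewrite -E.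
- by rewrite -E dual_form_reflection.
Qed.

Lemma real_root_sl2_root a : real_roots iota B a -> sl2_root a.
Proof.
case=> [[_ [x xa x0]] apos].
have aw : is_root0 a by exists x.
have [s [[aE|aE] _]] := root_word rels gen aw.
  by rewrite aE in aw apos *; apply: real_word_sl2_root => //; left.
rewrite aE; apply: sl2_root_opp; apply: real_word_sl2_root; first by right;
  rewrite -aE.
move: apos; rewrite aE (linN (dual_form_linear _)) dual_formC (linN (dual_form_linear _)).
by rewrite opprK.
Qed.

(** As $a(t)=(a\mid a)B(x,y)$ is nonzero, rescaling [y] by $2/a(t)$ gives the normalisation. *)
Lemma real_root_triple a : real_roots iota B a ->
  exists x y t, [/\ root_pair a x y, lie x y = iota t & a t = 2].
Proof.
move=> areal; have [[x [y xy]] _] := real_root_sl2_root areal;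
  case: areal => _ apos.
have [xa ya b0 dx dy] := xy.
have [t xyt tE] := opposite_bracket xa ya.
have at0 : a t != 0 by rewrite (dual_form_bracket xa ya xyt tE b0) mulf_neq0 // lt0r_neq0.
have c0 : 2 / a t != 0 by rewrite mulf_neq0 ?invr_eq0 // pnatr_eq0.
exists x, ((2 / a t) *: y), ((2 / a t) *: t); split.
- split=> //.
  + exact: (subspaceZ _ (weight_subspace iota adm _)).
  + by rewrite (linZ (Br _)) mulf_neq0.
  + move=> y' /dy[c ->]; exists (c / (2 / a t)).
    by rewrite scalerA divfK.
- by rewrite (linZ (lie_linearr x)) xyt linearZ.
- by rewrite linearZ -[LHS]/((2 / a t) * a t) divfK.
Qed.

Lemma sl2_root_vector_nilpotent a x : sl2_root a -> rs a x ->
  locally_nilpotent (lie x) /\ locally_nilpotent (rho x).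
Proof.
case=> _ [b1 _ b3 _] xa; split.
  exact: (string_nilpotent adm (ad_weight_spanned rels gen) xa b1).
exact: (string_nilpotent rhoM V_spanned xa b3).
Qed.

(** One nonzero vector controls the line $\mathfrak{g}_a$; [sl2_commutant] then passes to
    $\mathfrak{g}_{-a}$ on weight vectors, which span [V]. *)
Lemma commutant_opp (p : V -> V) a : linear p ->
  (forall t v, p (rho (iota t) v) = rho (iota t) (p v)) ->
  real_roots iota B a ->
  (exists2 x, rs a x & x <> 0 /\ forall v, p (rho x v) = rho x (p v)) ->
  (forall x, rs a x -> forall v, p (rho x v) = rho x (p v)) /\
  (forall y, rs (- a) y -> forall v, p (rho y v) = rho y (p v)).
Proof.
move=> lp pt areal [x0 x0a [x0n px0]]; have an := real_root_sl2_root areal.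
have [x [y [t [xy xyt a2]]]] := real_root_triple areal.
have [xa ya _ dx dy] := xy; have [ll lr lb] := rhoM.
have px v : p (rho x v) = rho x (p v).
  have [c x0E] := dx _ x0a.
  have c0 : c != 0 by apply/eqP => c0; apply: x0n; rewrite x0E c0 scale0r.
  have -> : x = c^-1 *: x0 by rewrite x0E scalerA mulVf // scale1r.
  by rewrite !(linZ (ll _)) (linZ lp) px0.
have py v : p (rho y v) = rho y (p v).
  apply: (lin_span_min (W := [set v | p (rho y v) = rho y (p v)])) (V_spanned v).
    split=> [|c u w /= pu pw] /=;
      first by rewrite !(lin0 (lr _)) (lin0 lp) (lin0 (lr _)).
    by rewrite lr lp pu pw lp lr.
  move=> w [mu wm] /=.
  have [nx ny] := (sl2_root_vector_nilpotent an xa, sl2_root_vector_nilpotent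
    (sl2_root_opp an) ya).
  have tr := root_triple rhoM xa ya xyt a2.
  exact: (sl2_commutant tr (proj2 nx) (proj2 ny) lp px (pt t) (wm t)).
split=> z za v; [have [c ->] := dx z za|have [c ->] := dy z za];
  by rewrite !(linZ (ll _)) (linZ lp) ?px ?py.
Qed.

(* If [lie x w = 0] and the weight of [w] is nonnegative, then [lie y u] is a
   multiple of [w], so [lie x (lie y u) = 0] although [u] has positive weight. *)
Lemma real_root_bracket a b z : real_roots iota B a -> real_roots iota B b ->
  real_roots iota B (a + b) -> rs (a + b) z ->
  exists c x y, [/\ rs a x, rs b y & z = c *: lie x y].
Proof.
move=> areal breal abreal zab; have an := real_root_sl2_root areal.
have [x [y [t [xy xyt a2]]]] := real_root_triple areal.
have [xa ya _ _ _] := xy.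
have [[w [w' [wb _ B0 dw _]]] _] := real_root_sl2_root breal.
have [[u [u' [uab _ B1 du _]]] _] := real_root_sl2_root abreal.
have w0 : w <> 0 by move=> w0; move: B0; rewrite w0 (lin0 (Bl _)) eqxx.
have u0 : u <> 0 by move=> u0; move: B1; rewrite u0 (lin0 (Bl _)) eqxx.
have [nx _] := sl2_root_vector_nilpotent an xa;
  have [ny _] := sl2_root_vector_nilpotent (sl2_root_opp an) ya.
have tr := root_triple adm xa ya xyt a2.
have xw : lie x w <> 0.
  move=> xw0; have [m bm] := weight_int tr w0 (wb t) nx ny.
  case: m bm => m bm.
    have Hu : lie (iota t) u = (m + 2)%:R *: u.
      by rewrite uab add_lfunE bm a2 natrD addrC.
    apply: u0; apply: (EF_positive_inj tr Hu nx ny).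
    have [c ->] : exists c, lie y u = c *: w.
      by apply: dw; have := rho_weight adm ya uab; rewrite addrAC subrr add0r.
    by rewrite (linZ (lie_linearr x)) xw0 scaler0.
  (* In the remaining case [w] has weight $-(m+1)<0$, where [lie x] itself is injective. *)
  apply: w0; apply: (iterE_inj (n := m.+1) (j := 1) tr _ (ny w)) => //.
  by rewrite wb bm NegzE rmorphN.
have xwab : rs (a + b) (lie x w) by rewrite addrC; exact: rho_weight.
have [c zE] := du z zab; have [d xwE] := du _ xwab.
have d0 : d != 0 by apply/eqP => d0; apply: xw; rewrite xwE d0 scale0r.
exists (c / d), x, w; split=> //.
by rewrite xwE scalerA divfK.
Qed.

End RealRoots.

(** * The projection attached to a decomposition, and its commutation with the whole algebra *)

Lemma projection_along (K : fieldType) (V : lmodType K) (W1 W2 : set V) :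
  is_subspace W1 -> is_subspace W2 -> W1 `&` W2 = [set 0] ->
  (forall v, exists v1 v2, [/\ W1 v1, W2 v2 & v = v1 + v2]) ->
  exists p : V -> V, [/\ linear p, forall v, W1 (p v), forall v, W2 (v - p v)
    & forall v u, W1 u -> W2 (v - u) -> p v = u].
Proof.
move=> s1 s2 W12 dec.
have dec' v : exists u, W1 u /\ W2 (v - u).
  by have [v1 [v2 [w1 w2 ->]]] := dec v; exists v1; rewrite addrC addKr.
have [p pP] := boolp.choice dec'.
have uniq v u : W1 u -> W2 (v - u) -> p v = u.
  move=> u1 u2; have [p1 p2] := pP v; apply: subr0_eq.
  suff : (W1 `&` W2) (p v - u) by rewrite W12.
  split; first exact: subspaceB.
  have -> : p v - u = (v - u) - (v - p v)
    by rewrite opprB [RHS]addrC addrA subrK.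
  exact: subspaceB.
exists p; split=> [a u v|v|v|] //; try by case: (pP v).
have [u1 u2] := pP u; have [v1 v2] := pP v.
apply: uniq; first by apply: (proj2 s1).
have -> : a *: u + v - (a *: p u + p v) = a *: (u - p u) + (v - p v).
  by rewrite scalerBr opprD addrACA.
exact: (proj2 s2).
Qed.

Unset Implicit Arguments.
Set Strict Implicit.

Theorem theorem3p3 (R : realType) (l : nat) (A : 'M[int]_l)
    (h : vectType R[i]) (alpha : 'I_l -> dual R[i] h) (alphav : 'I_l -> h)
    (g : lieAlgType R[i]) (iota : {linear h -> g}) (e f : 'I_l -> g)
    (B : {biscalar g}) (s : set g) :
  is_GCM A -> symmetrizable A R[i] ->
  is_realization A alpha alphav ->
  is_KacMoody A alpha alphav iota e f ->
  is_standard_form iota B A alpha ->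
  is_regular iota s -> range iota `<=` s ->
  let T := root_set iota s in
  range alpha `<=` real_closure iota B (T `|` [set - a | a in T]) ->
  wide iota e f s.
Proof.
move=> [A2 _ _] _ [_ alpha_free _ pairing] [rels gen _] standard _ hs T simple_cl.
move=> V rho lambda rhoM irr integ [_ [v0 [_ v0e v0w v0gen]]].
case=> W1 [W2 [[sub1 stab1] [sub2 stab2] [W1n W2n] W12 dec]].
have aa i : alpha i (alphav i) = 2 by rewrite pairing A2.
have [cf cf_lin cf_alpha] := free_coordinates alpha_free.
have nilp_e i : locally_nilpotent (rho (e i)) by move=> v; case: (integ i v).
have nilp_f i : locally_nilpotent (rho (f i)) by move=> v; case: (integ i v).
have spanned := highest_weight_spanned rels gen rhoM v0e v0w v0gen.
have bounded := highest_weight_string_bounded rels gen cf_lin cf_alpha rhoM v0e v0w v0gen.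
have [p [lp p1 p2 puniq]] := projection_along sub1 sub2 W12 dec.
(* Both summands are stable under [s], so [rho x (p v)] is the first component of [rho x v]. *)
have ps x v : s x -> p (rho x v) = rho x (p v).
  move=> sx; apply: puniq; first exact: stab1.
  by have [_ lr _] := rhoM; rewrite -(linB (lr x)); exact: stab2.
have pt t v : p (rho (iota t) v) = rho (iota t) (p v).
  by apply: ps; apply: hs; exists t.
have opp := commutant_opp rels gen pairing aa cf_lin cf_alpha standard rhoM
  nilp_e nilp_f spanned bounded lp pt.
have bracket := real_root_bracket rels gen pairing aa cf_lin cf_alpha standard rhoM
  nilp_e nilp_f spanned bounded.
pose S := [set a | real_roots iota B a /\
  forall x, root_space iota a x -> forall v, p (rho x v) = rho x (p v)].
have S_closed : real_closed iota B S.
  split=> [a []//|a b [ar pa] [br pb] abr];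
    split=> // z /(bracket _ _ _ ar br abr).
  have [ll lr lb] := rhoM.
  case=> c [x [y [xa yb ->]]] v; rewrite !(linZ (ll _)) (linZ lp) !lb (linB lp).
  by rewrite (pa x xa) !(pb y yb) (pa x xa).
(* By minimality of the real closure, it suffices that [S] contains the real roots of
   $T\cup(-T)$. *)
have S_simple i : S (alpha i).
  apply: (smallest_sub S_closed) (simple_cl (alpha i) _); last by exists i.
  have TS b : T b -> real_roots iota B b -> 
      exists2 x, root_space iota b x
        & x <> 0 /\ forall v, p (rho x v) = rho x (p v).
    by case=> _ [x [sx xb] xn] _; exists x => //; split=> // v; exact: ps.
  move=> a [[Ta|[b Tb <-]] ar].
    by split=> //; case: (opp _ ar (TS a Ta ar)).
  (* The root at hand is $-b$ with $b\in T$. Since $b$ has the same norm, [opp] applies to it, and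
     its second half covers $-b$. *)
  have br : real_roots iota B b.
    split; first by case: Tb.
    have [Bsym _ _ _ _] := standard.
    case: ar => _; rewrite (linN (dual_form_linear iota B _)).
    by rewrite (dual_formC standard) (linN (dual_form_linear iota B _)) opprK.
  by split=> //; case: (opp _ br (TS b Tb br)).
have p_comm x v : p (rho x v) = rho x (p v).
  have : [set: g] x by [].
  rewrite -(gen _ (commutant_subalgebra rhoM lp)) => [|t|i|i]; first exact.
  - by move=> w; exact: pt.
  - by have [_ pe] := S_simple i; apply: pe; exact: e_weight rels i.
  (* Commutation with [f i] follows from commutation with the root space of [alpha i]. *)
  - have [ar pe] := S_simple i; have [[_ [y ya yn]] _] := ar.
    apply: (proj2 (opp _ ar _)); last exact: f_weight rels i.
    by exists y => //; split=> // w; exact: pe.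
have p_id v : W1 v -> p v = v.
  by move=> v1; apply: puniq => //; rewrite subrr; case: sub2.
have sub_W1 : is_submodule rho setT W1.
  by split=> // x v _ v1; rewrite -(p_id v v1) -p_comm.
have [_ irr'] := irr; case: (irr' W1 sub_W1) => // W1T.
(* If $W_1=V$, then $W_2=W_1\cap W_2=0$, which is excluded. *)
by apply: W2n; rewrite -W12 W1T setTI.
Qed.
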